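(* For every integer $d\geq 2$, $e_{\mathrm{HK}}(S_{2,d})>e_{\mathrm{HK}}(R_{2,d})$.
   Context: For a Noetherian local ring $(R,\mathfrak{m})$ of prime characteristic $p$ and dimension $d$, let $\mathfrak{m}^{[p^e]}=(a^{p^e}:a\in\mathfrak{m})$, $\mathrm{HK}_e(R)=\operatorname{length}_R(R/\mathfrak{m}^{[p^e]})$, and $e_{\mathrm{HK}}(R)=\lim_{e\to\infty}\mathrm{HK}_e(R)/p^{ed}$ (the Hilbert–Kunz multiplicity; the limit exists). $R_{2,d}=\mathbb{F}_2[[x_0,\dots,x_d]]/(Q_d)$, where $Q_d=x_0x_1+x_2x_3+\dots+x_{d-1}x_d$ if $d$ is odd and $Q_d=x_0x_1+\dots+x_{d-2}x_{d-1}+x_d^2$ if $d$ is even. $S_{2,d}=\mathbb{F}_2[[x_0,\dots,x_d]]/(P_d)$, where $P_d=x_0x_1+\dots+x_{d-3}x_{d-2}+x_{d-1}^2+x_d^3$ if $d$ is odd and $P_d=x_0x_1+\dots+x_{d-2}x_{d-1}+x_d^3$ if $d$ is even. *)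

(* Defs.v *)
From HB Require Import structures.
From mathcomp Require Import all_boot all_order all_algebra.
From mathcomp Require Import generic_quotient ring_quotient.
From mathcomp Require Import all_classical all_reals all_analysis.
From mathcomp.multinomials Require mpoly.
Import -(notations) mpoly.

Set Implicit Arguments.
Unset Strict Implicit.
Unset Printing Implicit Defensive.

Import Order.TTheory GRing.Theory Num.Theory.
Import numFieldNormedType.Exports.
Local Open Scope classical_set_scope.
Local Open Scope ring_scope.

(* Formal power series in n variables: a series is its family of *)
(* coefficients, indexed by the exponents 'X_{1..n} of multinomials' mpoly. *)

Section PowerSeries.
Variables (n : nat) (R : comNzRingType).

Record mseries := MSeries { mscoef : multinom n -> R }.

HB.instance Definition _ := [isNew for mscoef].
HB.instance Definition _ := [Choice of mseries by <:].

Implicit Types f g h : mseries.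

Lemma mseriesP f g : (forall m, mscoef f m = mscoef g m) -> f = g.
Proof. by move=> fg; apply: val_inj; apply/funext. Qed.

Definition ms0 := MSeries (fun=> 0).
Definition msopp f := MSeries (fun m => - mscoef f m).
Definition msadd f g := MSeries (fun m => mscoef f m + mscoef g m).

Fact msaddA : associative msadd.
Proof. by move=> f g h; apply: mseriesP => m /=; rewrite addrA. Qed.
Fact msaddC : commutative msadd.
Proof. by move=> f g; apply: mseriesP => m /=; rewrite addrC. Qed.
Fact msadd0 : left_id ms0 msadd.
Proof. by move=> f; apply: mseriesP => m /=; rewrite add0r. Qed.
Fact msaddN : left_inverse ms0 msopp msadd.
Proof. by move=> f; apply: mseriesP => m /=; rewrite addNr. Qed.

HB.instance Definition _ :=
  GRing.isZmodule.Build mseries msaddA msaddC msadd0 msaddN.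

Definition ms1 := MSeries (fun m => (m == mnm0)%:R).

(* The Cauchy product; the exponents k.1, k.2 of a decomposition of m are *)
(* taken in the finite type of exponents of degree at most mdeg m. *)
Definition msmul f g := MSeries (fun m =>
  \sum_(k : bmultinom n (mdeg m).+1 * bmultinom n (mdeg m).+1
         | m == mnm_add k.1 k.2)
     mscoef f k.1 * mscoef g k.2).

Definition mstrunc b f : mpoly n R :=
  \sum_(k : bmultinom n b) mscoef f k *: mpolyX R k.

Lemma mstruncE b f m :
  (mdeg m < b)%N -> mcoeff m (mstrunc b f) = mscoef f m.
Proof.
move=> mb; rewrite /mstrunc raddf_sum /= (bigD1 (BMultinom mb)) //=.
rewrite mcoeffZ mcoeffX eqxx mulr1 big1 ?addr0 // => k kNm.
rewrite mcoeffZ mcoeffX [_ == m](_ : _ = false) ?mulr0 //.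
by apply: contraNF kNm => /eqP km; apply/eqP/val_inj.
Qed.

Lemma msmulE b f g m : (mdeg m < b)%N ->
  mscoef (msmul f g) m = mcoeff m (mstrunc b f * mstrunc b g).
Proof.
move=> mb; rewrite mcoeffM; apply: eq_bigr => k /eqP mE.
have lb (i : multinom n) : (mdeg i < (mdeg m).+1)%N -> (mdeg i < b)%N.
  by move=> im; apply: leq_ltn_trans mb; rewrite -ltnS.
by rewrite !mstruncE // lb // bmdeg.
Qed.

Lemma eq_mcoeffM b (p p' q q' : mpoly n R) m : (mdeg m < b)%N ->
  (forall k, (mdeg k < b)%N -> mcoeff k p = mcoeff k p') ->
  (forall k, (mdeg k < b)%N -> mcoeff k q = mcoeff k q') ->
  mcoeff m (p * q) = mcoeff m (p' * q').
Proof.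
move=> mb pp' qq'; rewrite !mcoeffM; apply: eq_bigr => k _.
by rewrite pp' ?qq' //; apply: leq_ltn_trans mb; rewrite -ltnS bmdeg.
Qed.

Fact msmulA : associative msmul.
Proof.
move=> f g h; apply: mseriesP => m.
pose T := mstrunc (mdeg m).+1.
rewrite !(@msmulE (mdeg m).+1) //.
rewrite (@eq_mcoeffM (mdeg m).+1 _ (T f) _ (T g * T h)) //; last first.
  by move=> k kb; rewrite mstruncE // (@msmulE (mdeg m).+1).
rewrite mulrA; apply: (@eq_mcoeffM (mdeg m).+1) => // k kb.
by rewrite mstruncE // (@msmulE (mdeg m).+1).
Qed.

Fact msmulC : commutative msmul.
Proof.
move=> f g; apply: mseriesP => m.
by rewrite !(@msmulE (mdeg m).+1) // mulrC.
Qed.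

Fact msmul1 : left_id ms1 msmul.
Proof.
move=> f; apply: mseriesP => m; rewrite (@msmulE (mdeg m).+1) //.
rewrite (@eq_mcoeffM (mdeg m).+1 _ 1 _ (mstrunc (mdeg m).+1 f)) //.
  by rewrite mul1r mstruncE.
by move=> k kb; rewrite mstruncE // mcoeff1.
Qed.

Fact msmulDl : left_distributive msmul +%R.
Proof.
move=> f g h; apply: mseriesP => m /=; rewrite -big_split /=.
by apply: eq_bigr => k _; rewrite mulrDl.
Qed.

Fact ms1_neq0 : ms1 != 0 :> mseries.
Proof.
apply/eqP => /(congr1 (fun f => mscoef f mnm0)) /= /eqP.
by rewrite eqxx oner_eq0.
Qed.

HB.instance Definition _ := GRing.Zmodule_isComNzRing.Build mseries
  msmulA msmulC msmul1 msmulDl ms1_neq0.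

Definition msvar (i : 'I_n) : mseries := MSeries (fun m => (m == mnm1 i)%:R).

Lemma mscoef0D f g :
  mscoef (f + g) mnm0 = mscoef f mnm0 + mscoef g mnm0.
Proof. by []. Qed.

Lemma mscoef0M f g :
  mscoef (f * g) mnm0 = mscoef f mnm0 * mscoef g mnm0.
Proof.
rewrite (@msmulE 1%N f g) ?mdeg0 // -!(@mstruncE 1%N _ mnm0) ?mdeg0 //.
exact: rmorphM (mcoeff (n:=n) (R:=R) mnm0) _ _.
Qed.

Lemma mscoef0_sum (I : Type) (r : seq I) (P : pred I) (F : I -> mseries) :
  mscoef (\sum_(i <- r | P i) F i) mnm0 =
  \sum_(i <- r | P i) mscoef (F i) mnm0.
Proof. by apply: (big_morph (fun f => mscoef f mnm0)). Qed.

Lemma mscoef0_var i : mscoef (msvar i) mnm0 = 0.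
Proof.
by rewrite /= [_ == _](_ : _ = false) // eq_sym; apply/eqP => /(congr1 mdeg);
   rewrite mdeg1 mdeg0.
Qed.

End PowerSeries.

(* Ideals and submodules are boolean predicates, as in ring_quotient; with *)
(* the classical axioms these are all subsets. *)

(* The maximum of P, and 0 by convention when P is empty or unbounded. *)
Definition nat_max (P : set nat) : nat :=
  xget 0%N [set n | P n /\ forall k, P k -> (k <= n)%N].

Definition psubset (T : Type) (X Y : {pred T}) : Prop :=
  {subset X <= Y} /\ ~ {subset Y <= X}.

Definition krull_dim (A : comNzRingType) : nat :=
  nat_max [set n | exists P : nat -> prime_idealr A,
    forall i, (i < n)%N -> psubset (P i) (P i.+1)].

Definition mod_length (A : comNzRingType) (M : lmodType A) : nat :=
  nat_max [set n | exists N : nat -> submodClosed M,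
    forall i, (i < n)%N -> psubset (N i) (N i.+1)].

Section QuotientModule.
Variables (A : comNzRingType) (V : lmodType A) (N : submodClosed V).

(* A submodClosed is only an additive submonoid for HB, whereas Quotient.quot *)
(* wants a zmodClosed. *)
Definition submod_pred : {pred V} := fun v => v \in N.

Fact submod_pred_zmod : zmod_closed submod_pred.
Proof. exact: GRing.submod_closedB (submodClosedP N). Qed.

HB.instance Definition _ :=
  GRing.isZmodClosed.Build V submod_pred submod_pred_zmod.

Definition quot_mod := Quotient.quot submod_pred.

HB.instance Definition _ := GRing.Zmodule.on quot_mod.

Lemma quot_modP (u v : V) :
  (\pi_quot_mod u == \pi_quot_mod v)%qT = (u - v \in N).
Proof. exact/esym/(Quotient.idealrBE submod_pred). Qed.

Definition quot_scale (a : A) (x : quot_mod) : quot_mod :=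
  \pi_quot_mod%qT (a *: repr x).

Lemma quot_scaleE a (v : V) :
  quot_scale a (\pi_quot_mod%qT v) = \pi_quot_mod%qT (a *: v).
Proof.
apply/eqP; rewrite quot_modP -scalerBr; apply: rpredZ.
by rewrite -quot_modP reprK.
Qed.

Fact quot_scalerA a b x : quot_scale a (quot_scale b x) = quot_scale (a * b) x.
Proof.
by elim/quotW: x => v; rewrite (quot_scaleE b) (quot_scaleE a) quot_scaleE scalerA.
Qed.
Fact quot_scale1r : left_id 1 quot_scale.
Proof. by elim/quotW=> v; rewrite quot_scaleE scale1r. Qed.
Fact quot_scalerDr : right_distributive quot_scale +%R.
Proof.
move=> a; elim/quotW=> u; elim/quotW=> v.
by rewrite !quot_scaleE -!(raddfD \pi_quot_mod%qT) quot_scaleE scalerDr.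
Qed.
Fact quot_scalerDl x : {morph quot_scale^~ x : a b / a + b}.
Proof.
elim/quotW: x => v a b.
by rewrite !quot_scaleE scalerDl (raddfD \pi_quot_mod%qT).
Qed.

HB.instance Definition _ := GRing.Zmodule_isLmodule.Build A quot_mod
  quot_scalerA quot_scale1r quot_scalerDr quot_scalerDl.

End QuotientModule.

(* The ideal generated by X, as a submodule of the regular module A^o; unlike *)
(* the idealr of ring_quotient it may be the whole ring. *)
Section IdealSpan.
Variables (A : comNzRingType) (X : {pred A}).

Definition ideal_span : {pred A^o} := fun y =>
  `[< forall I : submodClosed A^o, {subset X <= I} -> y \in I >].

Fact ideal_span_submod : GRing.subsemimod_closed ideal_span.
Proof.
split; first split.
- by apply/asboolP => I _; apply: rpred0.
- move=> u v /asboolP uX /asboolP vX; apply/asboolP => I XI.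
  by apply: rpredD; [apply: uX | apply: vX].
- move=> a u /asboolP uX; apply/asboolP => I XI.
  by apply: rpredZ; apply: uX.
Qed.

HB.instance Definition _ :=
  GRing.isSubmodClosed.Build A A^o ideal_span ideal_span_submod.

End IdealSpan.

(* In a local ring this is the maximal ideal. *)
Definition nonunits (A : comNzRingType) : {pred A} :=
  fun a => ~~ `[< exists b, a * b = 1 >].

Definition frob_power (A : comNzRingType) (m : {pred A}) (q : nat) :
    submodClosed A^o :=
  ideal_span (fun b => `[< exists2 a, a \in m & b = a ^+ q >]).

Definition HK (p e : nat) (A : comNzRingType) : nat :=
  mod_length (quot_mod (frob_power (@nonunits A) (p ^ e))).

Definition eHK (K : realType) (p : nat) (A : comNzRingType) : K :=
  limn (fun e => (HK p e A)%:R / (p ^ (e * krull_dim A))%:R : K).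

Definition principal (A : comNzRingType) (f : A) : {pred A} :=
  fun g => `[< exists h, g = h * f >].

Lemma principal_idealr n (R : comNzRingType) (f : mseries n R) :
  mscoef f mnm0 = 0 -> idealr_closed (principal f).
Proof.
move=> f0; split.
- by apply/asboolP; exists 0; rewrite mul0r.
- apply/asboolP => -[h /(congr1 (fun g => mscoef g mnm0)) /eqP].
  by rewrite mscoef0M f0 mulr0 /= eqxx oner_eq0.
- move=> a u v /asboolP[h ->] /asboolP[k ->]; apply/asboolP.
  by exists (a * h + k); rewrite mulrDl mulrA.
Qed.

Section Hypersurfaces.
Variable d : nat.

Definition xvar (i : nat) : mseries d.+1 'F_2 := msvar _ (inord i).

Definition Qser : mseries d.+1 'F_2 :=
  if odd d then \sum_(i < d.+1./2) xvar i.*2 * xvar i.*2.+1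
  else \sum_(i < d./2) xvar i.*2 * xvar i.*2.+1 + xvar d ^+ 2.

Definition Pser : mseries d.+1 'F_2 :=
  if odd d then
    \sum_(i < d.-1./2) xvar i.*2 * xvar i.*2.+1 + xvar d.-1 ^+ 2 + xvar d ^+ 3
  else \sum_(i < d./2) xvar i.*2 * xvar i.*2.+1 + xvar d ^+ 3.

Lemma xvar0 i : mscoef (xvar i) mnm0 = 0. Proof. exact: mscoef0_var. Qed.

Lemma sumXX0 k : mscoef (\sum_(i < k) xvar i.*2 * xvar i.*2.+1) mnm0 = 0.
Proof. by rewrite mscoef0_sum big1 // => i _; rewrite mscoef0M xvar0 mul0r. Qed.

Lemma Xexp0 i k : mscoef (xvar i ^+ k.+1) mnm0 = 0.
Proof. by rewrite exprS mscoef0M xvar0 mul0r. Qed.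

Lemma Qser0 : mscoef Qser mnm0 = 0.
Proof.
by rewrite /Qser; case: ifP => _; rewrite ?mscoef0D sumXX0 ?Xexp0 ?addr0.
Qed.

Lemma Pser0 : mscoef Pser mnm0 = 0.
Proof.
by rewrite /Pser; case: ifP => _; rewrite !mscoef0D sumXX0 !Xexp0 ?addr0.
Qed.

Definition idealQ : {pred mseries d.+1 'F_2} := principal Qser.
Definition idealP : {pred mseries d.+1 'F_2} := principal Pser.

HB.instance Definition _ := isIdealr.Build _ idealQ (principal_idealr Qser0).
HB.instance Definition _ := isIdealr.Build _ idealP (principal_idealr Pser0).

Definition R2 : comNzRingType := {ideal_quot idealQ}.
Definition S2 : comNzRingType := {ideal_quot idealP}.

End Hypersurfaces.

(* Main.v *)
Require Import Defs.
From HB Require Import structures.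
From mathcomp Require Import all_boot all_order all_algebra finfield.
From mathcomp Require Import generic_quotient ring_quotient.
From mathcomp Require Import ring zify.
From mathcomp Require Import boolp all_reals topology normedtype sequences.
From mathcomp.multinomials Require mpoly.
Import -(notations) mpoly.

Set Implicit Arguments.
Unset Strict Implicit.
Unset Printing Implicit Defensive.

Import Order.TTheory GRing.Theory Num.Theory.
Import numFieldNormedType.Exports.
Local Open Scope ring_scope.

(**
Write q = 2^e, and let f be one of the two power series Q_d, P_d in the n = d + 1
variables x_0, ..., x_d over F_2. The box module V_q = F_2[[x]] / (x_0^q, ..., x_d^q)
is finite, and the length of R/m^[q] for R = F_2[[x]]/(f) is the dimension of
V_q / f V_q (HK_kerdim), that is the dimension K_q(f) of the kernel of f on V_q
(kerdim). Both rings have Krull dimension d, so the theorem compares the limits of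
K_q(f) / q^d.

Two facts about K_q drive the proof. The number K_q(f^k) is a concave function of k
(kerdim_concave), as for the powers of any endomorphism; and since f^2 = f(x^2) over
F_2, V_(2q) with f^2 splits into 2^n copies of V_q with f, so that
K_(2q)(f^2) = 2^n K_q(f) (kerdim_double). As K_(2q)(f^2) <= 2 K_(2q)(f), the sequence
K_q(f) / q^d is nondecreasing (kerdim_grows); it is bounded, hence converges, and its
limit is at least each of its terms.

Let F = x_0 x_1 + ... have m terms, in 2m variables, and let c = K_2(F). All four
multiplicities are compared with 2c/4^m, where m is half of d, rounded down.
- For S, at q = 2 the powers z^2 and w^3 of the last variables vanish, and the term
  K_2(P_d)/2^d is 2c/4^m, which bounds the limit from below. For d even the step from
  q = 2 to q = 4 is strict: x_0^3 x_2^3 ... z is killed by P_d on V_4 without being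
  a multiple of it (kerdim_sq_lt_corner).
- For R and d even, Q_d = F + z^2. A kernel element is determined by its coefficients
  at z^(q-1) and z^(q-2), which are killed by F^(q/2) (kerdim_add_pow). So K_q(Q_d)
  is at most 2 K_q(F^(q/2)) = 2 (q/2)^(2m) c.
- For R and d odd, Q_d = F + xy. Splitting V_q along the monomials in x and y gives
  K_q(Q_d) <= sum over j < q of a_j + a_(j+1), with a_j = K_q(F^j) (kerdim_add_mul).
  Pairing a_j with a_(q-j), concavity bounds each pair by 2 a_(q/2) = 2 (q/2)^(2m) c.
  Because a_q <= q^(2m) < 2 a_(q/2), while a_j is small for j small against q, a
  positive proportion of the pairs falls short by a fixed proportion of q^(2m)
  (kerdim_quadS_gap), which makes the inequality strict in the limit.

The Krull dimension is found as follows. A chain of primes of F_2[[x_1, ..., x_n]] has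
length at most n, by induction on n (prime_chain_bound): a nonzero series in the second
prime becomes regular in the last variable t after a substitution x_i -> x_i + t^(c_i),
Weierstrass division then makes all series integral, modulo it, over the series in the
other variables, and a chain of primes restricts to a strict chain there. Conversely
x_1 -> x_1, x_i -> x_1 x_i for i >= 2 extends to a substitution that kills f, because
x_0 x_1 occurs in f and the image of the rest is divisible by x_1; the coordinate primes
pull back to a chain of length d (hypersurface_chain).
*)

(** * Coefficients of power series *)

Section Coefficients.
Variable n : nat.
Local Notation mS := (mseries n 'F_2).
Implicit Types (f g h : mS) (m a b : multinom n).

Lemma mscoefD f g m : mscoef (f + g) m = mscoef f m + mscoef g m.
Proof. by []. Qed.
Lemma mscoef1 m : mscoef (1 : mS) m = (m == mnm0)%:R.
Proof. by []. Qed.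

Lemma mscoefB f g m : mscoef (f - g) m = mscoef f m - mscoef g m.
Proof. by []. Qed.

Lemma mscoef_sum (I : Type) (r : seq I) (P : pred I) (F : I -> mS) m :
  mscoef (\sum_(i <- r | P i) F i) m = \sum_(i <- r | P i) mscoef (F i) m.
Proof. by apply: (big_morph (fun f => mscoef f m)). Qed.

Lemma mscoefM_eq0 f g m :
  (forall a b, m = mnm_add a b -> mscoef f a * mscoef g b = 0) ->
  mscoef (f * g) m = 0.
Proof. by move=> fg0; apply: big1 => k /eqP /fg0. Qed.

(** The extremal decomposition argument: a product has a prescribed coefficient as soon
as all other decompositions of the exponent contribute nothing. *)
Lemma mscoefM1 f g a b :
  (forall a' b', mnm_add a b = mnm_add a' b' -> a' != a ->
     mscoef f a' * mscoef g b' = 0) ->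
  mscoef (f * g) (mnm_add a b) = mscoef f a * mscoef g b.
Proof.
move=> fg0; set m := mnm_add a b.
have am : (mdeg a < (mdeg m).+1)%N by rewrite ltnS /m mdegD leq_addr.
have bm : (mdeg b < (mdeg m).+1)%N by rewrite ltnS /m mdegD leq_addl.
have -> : mscoef (f * g) m = \sum_(k : bmultinom n (mdeg m).+1 *
  bmultinom n (mdeg m).+1 | m == mnm_add k.1 k.2)
   mscoef f k.1 * mscoef g k.2 by [].
rewrite (bigD1 (BMultinom am, BMultinom bm)) //= big1 ?addr0 //.
move=> [k1 k2] /= /andP[/eqP mE kN]; apply: fg0 => //.
apply: contraNneq kN => k1E; rewrite xpair_eqE; apply/andP; split.
  by apply/eqP/val_inj.
apply/eqP/val_inj => /=; move: mE; rewrite /m k1E => /addmI.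
by [].
Qed.

Lemma eq_mscoefM N f f' g g' m : (mdeg m < N)%N ->
  (forall a, (mdeg a < N)%N -> mscoef f a = mscoef f' a) ->
  (forall a, (mdeg a < N)%N -> mscoef g a = mscoef g' a) ->
  mscoef (f * g) m = mscoef (f' * g') m.
Proof.
move=> mN ff' gg'; apply: eq_bigr => k _.
by rewrite ff' ?gg' // (leq_trans (bmdeg _)).
Qed.

Definition msmon a : mS := MSeries (fun m => (m == a)%:R).

Lemma msmonE i : msvar 'F_2 i = msmon (mnm1 i) :> mS. Proof. by []. Qed.

Lemma mscoef_monM a g m :
  mscoef (msmon a * g) m = if lem a m then mscoef g (mnm_sub m a) else 0.
Proof.
case: ifP => [am|/negbT amF].
  have -> : m = mnm_add a (mnm_sub m a) by rewrite addmC submK.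
  rewrite mscoefM1 /= ?eqxx ?mul1r; last first.
    by move=> a' b' _ /negbTE /= ->; rewrite mul0r.
  by rewrite [in RHS]addmC addmK.
apply: mscoefM_eq0 => a' b' mE /=; case: eqP => [a'E|]; last by rewrite mul0r.
by move: amF; rewrite mE a'E lem_addr.
Qed.

Lemma msmonD a b : msmon (mnm_add a b) = msmon a * msmon b.
Proof.
apply: mseriesP => m; rewrite mscoef_monM /=; case: ifP => [am|/negbT am].
  congr (_%:R); congr nat_of_bool; apply/eqP/eqP => [->|<-].
    by rewrite addmC addmK.
  by rewrite addmC submK.
by case: eqP => // mE; rewrite mE lem_addr in am.
Qed.

Lemma msmon0 : msmon (mnm0) = 1. Proof. exact: mseriesP. Qed.

Lemma msmonX a (k : nat) : msmon a ^+ k = msmon (mnm_muln a k).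
Proof.
elim: k => [|k IH]; first by rewrite mulm0n msmon0.
by rewrite exprS IH mulmS msmonD.
Qed.

Lemma mscoef_varXM i q g m : mscoef (msvar 'F_2 i ^+ q * g) m =
  if (q <= m i)%N then mscoef g (mnm_sub m (mnm_muln (mnm1 i) q)) else 0.
Proof.
rewrite msmonE msmonX mscoef_monM; congr (if _ then _ else _).
apply/mnm_lepP/idP => [/(_ i)|qm j]; rewrite mulmnE mnm1E ?eqxx ?mul1n //.
by case: eqP => [<-|_]; rewrite ?mul1n ?mul0n.
Qed.

Lemma mscoef_varM i g m : mscoef (msvar 'F_2 i * g) m =
  if (0 < m i)%N then mscoef g (mnm_sub m (mnm1 i)) else 0.
Proof. by rewrite -[msvar _ i]expr1 mscoef_varXM mulm1n. Qed.

Lemma msmon_prod a : msmon a = \prod_(i < n) msvar 'F_2 i ^+ a i.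
Proof.
rewrite [in LHS](multinomUE_id a).
have -> : forall r : seq 'I_n,
    msmon (\big[@mnm_add n/@mnm0 n]_(i <- r) mnm_muln (mnm1 i) (a i)) =
    \prod_(i <- r) msvar 'F_2 i ^+ a i => //.
elim=> [|i r IH]; first by rewrite !big_nil msmon0.
by rewrite !big_cons msmonD IH msmonE msmonX.
Qed.

(** The power series form of the Banach fixed point theorem. The degree delta is left free,
since Weierstrass division contracts only for the degree in some of the variables: the
iterates of 0 stabilize on the exponents of each delta, whose number may be infinite. *)
Lemma contraction_fix (T : mS -> mS) (delta : multinom n -> nat) :
  (forall u v N, (forall m, (delta m < N)%N -> mscoef u m = mscoef v m) ->
    (forall m, (delta m < N.+1)%N -> mscoef (T u) m = mscoef (T v) m)) ->
  exists u, T u = u.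
Proof.
move=> Tc; pose s k := iter k T 0.
have ss k : forall m, (delta m < k)%N -> mscoef (s k) m = mscoef (s k.+1) m.
  by elim: k => [//|k IH] m mk; apply: (Tc (s k) (s k.+1) k).
have sl k l : (k <= l)%N ->
    forall m, (delta m < k)%N -> mscoef (s k) m = mscoef (s l) m.
  move=> /subnKC <-; elim: (l - k)%N => [|j IH] m mk; first by rewrite addn0.
  by rewrite IH // addnS ss // (leq_trans mk) // leq_addr.
pose u := MSeries (fun m => mscoef (s (delta m).+1) m) : mS.
have us k m : (delta m < k)%N -> mscoef u m = mscoef (s k) m.
  by move=> mk; rewrite /= (sl (delta m).+1 k).
exists u; apply: mseriesP => m; rewrite (us (delta m).+1) //.
exact: (Tc u (s (delta m)) (delta m) (us (delta m)) m (ltnSn _)).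
Qed.

(** Multiplication by a series without terms of degree 0 is a contraction. *)
Lemma mscoefM_agree (delta : multinom n -> nat) N f u v :
  {morph delta : a b / mnm_add a b >-> (a + b)%N} ->
  (forall m, delta m = 0%N -> mscoef f m = 0) ->
  (forall m, (delta m < N)%N -> mscoef u m = mscoef v m) ->
  (forall m, (delta m < N.+1)%N -> mscoef (f * u) m = mscoef (f * v) m).
Proof.
move=> dD f0 uv m mN; apply/eqP; rewrite -subr_eq0 -mscoefB -mulrBr; apply/eqP.
apply: mscoefM_eq0 => a b mE.
have [/eqP/f0 ->|da] := boolP (delta a == 0%N); first by rewrite mul0r.
rewrite mscoefB uv ?subrr ?mulr0 //.
rewrite -ltnS (leq_trans _ mN) // ltnS mE dD.
by rewrite -[X in (X < _)%N]add0n ltn_add2r lt0n.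
Qed.

(** The inverse of f is the fixed point of u |-> 1 + (1 - f) u. *)
Lemma mseries_unit f : mscoef f mnm0 = 1 -> exists g, f * g = 1.
Proof.
move=> f1; have [|g gE] := @contraction_fix (fun u => 1 + (1 - f) * u) (@mdeg n).
  move=> u v N uv m mN; rewrite !mscoefD; congr (_ + _).
  apply: (@mscoefM_agree (@mdeg n) N) => //; first exact: mdegD.
  by move=> k /eqP; rewrite mdeg_eq0 => /eqP ->; rewrite mscoefB f1 mscoef1 eqxx subrr.
exists g; move: gE; rewrite mulrBl mul1r addrCA => /eqP.
by rewrite -[X in _ == X]addr0 (inj_eq (addrI g)) subr_eq0 => /eqP.
Qed.

End Coefficients.

Lemma F2E (c : 'F_2) : c = (c != 0)%:R.
Proof. by case: c => -[|[|]] //= ?; apply/val_inj. Qed.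

Lemma mseries_char2 n (f : mseries n 'F_2) : f + f = 0.
Proof.
apply: mseriesP => m; rewrite mscoefD [mscoef f m]F2E; case: (_ != 0) => /=.
  exact/val_inj.
by rewrite addr0.
Qed.

Lemma mseries_oppr n (f : mseries n 'F_2) : - f = f.
Proof. by apply/eqP; rewrite eq_sym -addr_eq0 mseries_char2. Qed.

(** * Substitution of power series without constant term *)

Section Substitution.
Variables (n k : nat).

Definition msC (c : 'F_2) : mseries k 'F_2 :=
  MSeries (fun m => c * (m == mnm0)%:R).

Lemma mscoef_CM c f m : mscoef (msC c * f) m = c * mscoef f m.
Proof.
have -> : m = mnm_add mnm0 m by rewrite add0m.
rewrite mscoefM1 /= ?eqxx ?mulr1 ?add0m // => a b _ /negbTE /= ->.
by rewrite mulr0 mul0r.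
Qed.

Fact msC_zmod : zmod_morphism msC.
Proof. by move=> a b; apply: mseriesP => m /=; rewrite mulrBl. Qed.
Fact msC_monoid : monoid_morphism msC.
Proof.
by split=> [|a b]; apply: mseriesP => m; rewrite ?mscoef_CM /= ?mul1r ?mulrA.
Qed.
HB.instance Definition _ := GRing.isZmodMorphism.Build _ _ msC msC_zmod.
HB.instance Definition _ := GRing.isMonoidMorphism.Build _ _ msC msC_monoid.

Definition ord_ge b (f : mseries k 'F_2) :=
  forall m, (mdeg m < b)%N -> mscoef f m = 0.

Lemma ord_geM b c f g : ord_ge b f -> ord_ge c g -> ord_ge (b + c) (f * g).
Proof.
move=> fb gc m mbc; apply: mscoefM_eq0 => u v mE.
have [ub|bu] := ltnP (mdeg u) b; first by rewrite fb ?mul0r.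
rewrite gc ?mulr0 //; move: mbc; rewrite mE mdegD => uvbc.
by rewrite -(ltn_add2l b) (leq_ltn_trans _ uvbc) // leq_add2r.
Qed.

Lemma ord_geX j f : ord_ge 1 f -> ord_ge j (f ^+ j).
Proof.
by move=> f1; elim: j => // j IH; rewrite exprS -[j.+1]add1n; apply: ord_geM.
Qed.

Variable h : 'I_n -> mseries k 'F_2.
Hypothesis h0 : forall i, mscoef (h i) mnm0 = 0.

Let h1 i : ord_ge 1 (h i).
Proof. by move=> m; rewrite ltnS leqn0 mdeg_eq0 => /eqP ->. Qed.

Lemma ord_ge_mmap1 m : ord_ge (mdeg m) (mmap1 h m).
Proof.
rewrite mdegE /mmap1; elim/big_ind2: _ => [|b f c g fb gc|i _] //.
  exact: ord_geM.
exact: ord_geX.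
Qed.

Lemma mmap_ord b p : (forall m, (mdeg m < b)%N -> mcoeff m p = 0) ->
  ord_ge b (mmap msC h p).
Proof.
move=> p0 m mb; rewrite /mmap mscoef_sum big1 // => a _.
rewrite mscoef_CM; have [ab|ba] := ltnP (mdeg a) b; first by rewrite p0 ?mul0r.
by rewrite (ord_ge_mmap1 (leq_trans mb ba)) mulr0.
Qed.

(** The coefficient at m only involves the terms of f of degree at most mdeg m, whence a
substitution into a polynomial. *)
Fact subst_key : unit. Proof. exact: tt. Qed.
Definition subst (f : mseries n 'F_2) : mseries k 'F_2 := locked_with subst_key
  (MSeries (fun m => mscoef (mmap msC h (mstrunc (mdeg m).+1 f)) m)).

Lemma mscoef_mmap_eq b p p' m : (mdeg m < b)%N ->
  (forall m, (mdeg m < b)%N -> mcoeff m p = mcoeff m p') ->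
  mscoef (mmap msC h p) m = mscoef (mmap msC h p') m.
Proof.
move=> mb pp'; apply/eqP; rewrite -subr_eq0 -mscoefB -mmapB; apply/eqP.
by apply: (@mmap_ord b) => // a ab; rewrite mcoeffB pp' ?subrr.
Qed.

Lemma substE b f m : (mdeg m < b)%N ->
  mscoef (subst f) m = mscoef (mmap msC h (mstrunc b f)) m.
Proof.
move=> mb; rewrite /subst unlock.
apply: (@mscoef_mmap_eq (mdeg m).+1) => // a am.
by rewrite !mstruncE // (leq_trans am).
Qed.

Fact subst_zmod : zmod_morphism subst.
Proof.
move=> f g; apply: mseriesP => m.
have mb := ltnSn (mdeg m).
apply: (etrans (substE (f - g) mb)); apply: esym.
apply: (etrans (mscoefB _ _ _)).
apply: (etrans (congr2 (fun x y => x - y) (substE f mb) (substE g mb))).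
rewrite -mscoefB -mmapB.
apply: (@mscoef_mmap_eq (mdeg m).+1) => // a am.
by rewrite mcoeffB !mstruncE.
Qed.

Fact subst_monoid : monoid_morphism subst.
Proof.
split=> [|f g]; apply: mseriesP => m.
  rewrite (@substE (mdeg m).+1) // -(rmorph1 (mmap msC h)).
  by apply: (@mscoef_mmap_eq (mdeg m).+1) => // a am; rewrite mstruncE // mcoeff1.
set b := (mdeg m).+1; have mb : (mdeg m < b)%N by [].
apply: (etrans (substE (f * g) mb)).
rewrite (@mscoef_mmap_eq b _ (mstrunc b f * mstrunc b g)) //.
  rewrite rmorphM; apply: (eq_mscoefM mb) => a ab; exact/esym/substE.
by move=> a ab; rewrite mstruncE // (@msmulE _ _ b).
Qed.

Lemma subst_var i : subst (msvar 'F_2 i) = h i.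
Proof.
apply: mseriesP => m; rewrite (@substE (mdeg m).+2) ?leqnSn //.
have -> : mstrunc (mdeg m).+2 (msvar 'F_2 i) = mpolyX 'F_2 (mnm1 i).
  rewrite /mstrunc; have i1 : (mdeg (mnm1 i) < (mdeg m).+2)%N by rewrite mdeg1.
  rewrite (bigD1 (BMultinom i1)) //= eqxx scale1r big1 ?addr0 // => a aN.
  by case: eqP => [aE|]; rewrite ?scale0r //; case/eqP: aN; apply/val_inj.
by rewrite mmapX mmap1U.
Qed.

Lemma mscoef_subst b f m : (mdeg m < b)%N -> mscoef (subst f) m =
  \sum_(a : bmultinom n b) mscoef f a * mscoef (mmap1 h a) m.
Proof.
move=> mb; rewrite (substE f mb) /mstrunc raddf_sum mscoef_sum.
by apply: eq_bigr => a _ /=; rewrite mmapZ mmapX mscoef_CM.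
Qed.

Lemma ord_ge_subst b f : (forall m, (mdeg m < b)%N -> mscoef f m = 0) ->
  ord_ge b (subst f).
Proof.
move=> f0 m mb; rewrite (mscoef_subst f (ltnSn (mdeg m))) big1 // => a _.
by rewrite f0 ?mul0r // (leq_trans (bmdeg a)).
Qed.

End Substitution.

Section Hom.
Variables (n k : nat) (h : 'I_n -> mseries k 'F_2).
Hypothesis h0 : forall i, mscoef (h i) mnm0 = 0.
Lemma subst_hom : exists2 s : {rmorphism mseries n 'F_2 -> mseries k 'F_2},
  (s : _ -> _) = subst h & forall i, s (msvar 'F_2 i) = h i.
Proof.
pose A := GRing.isZmodMorphism.Build _ _ (subst h) (subst_zmod h0).
pose B := GRing.isMonoidMorphism.Build _ _ (subst h) (subst_monoid h0).
pose s : {rmorphism mseries n 'F_2 -> mseries k 'F_2} := HB.pack (subst h) A B.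
by exists s => // i; apply: subst_var.
Qed.
End Hom.

Lemma mseries_trunc n b (f : mseries n 'F_2) :
  exists r : seq (multinom n), ord_ge b (f - \sum_(a <- r) msmon a).
Proof.
exists [seq bmnm a | a <- index_enum (bmultinom n b) & mscoef f (bmnm a) == 1].
move=> m mb.
rewrite mscoefB mscoef_sum big_map big_filter /=.
have [mf|mf] := boolP (mscoef f m == 1).
  rewrite (eqP mf) (bigD1 (BMultinom mb)) //= eqxx big1 ?addr0 ?subrr //.
  move=> a /andP[_ aN].
  by case: eqP => // mE; case/eqP: aN; apply/val_inj.
rewrite big1 ?subr0.
  have: forall c : 'F_2, c != 1 -> c = 0 by case=> -[|[|]] //= c _; apply/val_inj.
  exact.
by move=> a af; case: eqP => // mE; rewrite mE af in mf.
Qed.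

(** It is enough to check an involution on the variables: up to terms of high degree, a
series is a sum of monomials, and substitution does not lower the degree. *)
Lemma subst_invol n (h : 'I_n -> mseries n 'F_2)
  (h0 : forall i, mscoef (h i) mnm0 = 0) :
  (forall i, subst h (h i) = msvar 'F_2 i) -> involutive (subst h).
Proof.
move=> hh f; have [s sE _] := subst_hom h0.
have sv i : s (s (msvar 'F_2 i)) = msvar 'F_2 i by rewrite sE subst_var.
apply: mseriesP => m; have [r rf] := mseries_trunc (mdeg m).+1 f.
set p := \sum_(a <- r) _ in rf.
have sp : s (s p) = p.
  rewrite /p !rmorph_sum; apply: eq_bigr => a _.
  rewrite msmon_prod !rmorph_prod; apply: eq_bigr => i _.
  by rewrite !rmorphXn /= sv.
have fE : f = f - p + p by rewrite subrK.
move: (f - p) fE rf => g -> g0; rewrite -sE !rmorphD !mscoefD sp.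
congr (_ + _); rewrite (g0 m (ltnSn _)) sE.
exact: (ord_ge_subst h0 (ord_ge_subst h0 g0) (ltnSn _)).
Qed.

(** * Adding a last variable *)

Section Extension.
Variable n : nat.
Implicit Types (a b : multinom n) (m : multinom n.+1).

Definition mext a k : multinom n.+1 :=
  Multinom (mktuple (fun i : 'I_n.+1 =>
    if insub (i : nat) is Some j then a j else k)).
Definition mrestr m : multinom n :=
  Multinom (mktuple (fun i : 'I_n => m (widen_ord (leqnSn n) i))).

Local Notation wid := (widen_ord (leqnSn n)).

Lemma mext_widen a k i : mext a k (wid i) = a i.
Proof.
rewrite mnmE insubT //= => i_n; congr (fun_of_multinom a _); exact/val_inj.
Qed.

Lemma mext_max a k : mext a k ord_max = k.
Proof. by rewrite mnmE insubF //= ltnn. Qed.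

Lemma mrestrE m i : mrestr m i = m (wid i).
Proof. by rewrite mnmE. Qed.

Variant ordS_spec : 'I_n.+1 -> Type :=
  | OrdSwid i : ordS_spec (wid i)
  | OrdSmax : ordS_spec ord_max.

Lemma ordSP i : ordS_spec i.
Proof.
have [i_n|n_i] := ltnP i n.
  by have -> : i = wid (Ordinal i_n); [exact/val_inj|constructor].
have -> : i = ord_max; last by constructor.
by apply/val_inj/eqP; rewrite /= eqn_leq n_i -ltnS ltn_ord.
Qed.

Lemma mext_restr m : mext (mrestr m) (m ord_max) = m.
Proof.
by apply/mnmP => i; case: (ordSP i) => [j|];
  rewrite ?mext_widen ?mext_max ?mrestrE.
Qed.

Lemma mrestr_ext a k : mrestr (mext a k) = a.
Proof. by apply/mnmP => i; rewrite mrestrE mext_widen. Qed.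

Lemma mextD a b k l : mext (mnm_add a b) (k + l) = mnm_add (mext a k) (mext b l).
Proof.
by apply/mnmP => i; rewrite mnmDE; case: (ordSP i) => [j|];
  rewrite ?mext_widen ?mext_max ?mnmDE.
Qed.

Lemma mext_inj a b k l : mext a k = mext b l -> a = b /\ k = l.
Proof.
by move=> e; rewrite -(mrestr_ext a k) e mrestr_ext -(mext_max a k) e mext_max.
Qed.

Lemma mext1_wid i : mext (mnm1 i) 0 = mnm1 (wid i).
Proof.
apply/mnmP => j; rewrite mnm1E; case: (ordSP j) => [l|].
  by rewrite mext_widen mnm1E; congr nat_of_bool; rewrite -val_eqE.
by rewrite mext_max -val_eqE /= ltn_eqF.
Qed.

Lemma mext0n k : mext mnm0 k = mnm_muln (mnm1 ord_max) k.
Proof.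
apply/mnmP => j; rewrite mulmnE mnm1E; case: (ordSP j) => [l|].
  by rewrite mext_widen mnm0E -val_eqE /= gtn_eqF.
by rewrite mext_max eqxx mul1n.
Qed.

Definition lift_series : mseries n 'F_2 -> mseries n.+1 'F_2 :=
  subst (fun i => msvar 'F_2 (wid i)).

Fact lift_series0 (i : 'I_n) : mscoef (msvar 'F_2 (wid i)) mnm0 = 0.
Proof. exact: mscoef0_var. Qed.

HB.instance Definition _ := GRing.isZmodMorphism.Build _ _ lift_series
  (subst_zmod lift_series0).
HB.instance Definition _ := GRing.isMonoidMorphism.Build _ _ lift_series
  (subst_monoid lift_series0).

Lemma mscoef_lift f a k : mscoef (lift_series f) (mext a k) =
  if k == 0%N then mscoef f a else 0.
Proof.
have E b : mmap1 (fun i => msvar 'F_2 (wid i)) b = msmon (mext b 0).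
  rewrite msmon_prod big_ord_recr /= mext_max expr0 mulr1.
  by apply: eq_bigr => i _; rewrite mext_widen.
rewrite (mscoef_subst lift_series0 f (ltnSn _)).
under eq_bigr do rewrite E /=.
have ab : (mdeg a < (mdeg (mext a k)).+1)%N.
  rewrite ltnS !mdegE big_ord_recr /= mext_max.
  by under [X in (_ <= X + _)%N]eq_bigr do rewrite mext_widen; rewrite leq_addr.
rewrite (bigD1 (BMultinom ab)) //= big1 ?addr0 => [|b bN].
  case: eqP => [/mext_inj[_ ->]|]; first by rewrite mulr1.
  by case: eqP => [->|]; rewrite ?mulr0.
case: eqP => [/mext_inj[ba _]|]; rewrite ?mulr0 //.
by case/eqP: bN; apply/val_inj.
Qed.

End Extension.

(** * Weierstrass division and integrality *)

Section Weierstrass.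
Variable n : nat.
Implicit Types (f g h u v : mseries n.+1 'F_2) (m a b : multinom n.+1).
Local Notation t := (@ord_max n).
Local Notation tX w := (mnm_muln (mnm1 t) w).
Local Notation T := (msvar 'F_2 t).

Definition xdeg m := (\sum_(i < n) m (widen_ord (leqnSn n) i))%N.

Lemma xdegD : {morph xdeg : a b / mnm_add a b >-> (a + b)%N}.
Proof.
by move=> a b; rewrite /xdeg -big_split; apply: eq_bigr => i _; rewrite mnmDE.
Qed.

Lemma xdeg_tX w : xdeg (tX w) = 0%N.
Proof.
by apply: big1 => i _; rewrite mulmnE mnm1E -val_eqE /= gtn_eqF.
Qed.

Lemma xdeg0P m : xdeg m = 0%N -> m = tX (m t).
Proof.
move=> m0; have {}m0 i : m (widen_ord (leqnSn n) i) = 0%N.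
  apply/eqP; move/eqP: m0; rewrite /xdeg (bigD1 i) //= addn_eq0.
  by case/andP.
rewrite -mext0n -[LHS]mext_restr; congr (mext _ _).
by apply/mnmP => i; rewrite mrestrE mnm0E m0.
Qed.

Definition tquo w u : mseries n.+1 'F_2 :=
  MSeries (fun m => mscoef u (mnm_add m (tX w))).

Lemma tquoB w u v : tquo w (u - v) = tquo w u - tquo w v.
Proof. exact: mseriesP. Qed.

Lemma tquoXM w u : tquo w (T ^+ w * u) = u.
Proof.
apply: mseriesP => m; rewrite /= -[LHS]/(mscoef (T ^+ w * u) _) mscoef_varXM.
by rewrite mnmDE mulmnE mnm1E eqxx mul1n leq_addl addmK.
Qed.

(** Each u is uniquely tlow w u + t^w * tquo w u with tlow w u of t-degree below w. *)
Definition tlow w u := u - T ^+ w * tquo w u.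

Lemma le_tX w m : (w <= m t)%N -> mnm_add (mnm_sub m (tX w)) (tX w) = m.
Proof.
move=> wm; rewrite submK //; apply/mnm_lepP => i; rewrite mulmnE mnm1E.
by case: eqP => [<-|]; rewrite ?mul1n.
Qed.

Lemma mscoef_tlow w u m :
  mscoef (tlow w u) m = if (w <= m t)%N then 0 else mscoef u m.
Proof.
rewrite /tlow mscoefB mscoef_varXM; case: ifP => wm; last by rewrite subr0.
by rewrite /= le_tX // subrr.
Qed.

(** With g = low + t^w v, where v is a unit, division by g amounts to finding Q = q v such
that Q = tquo w h - tquo w (Q low / v). No term of low is a pure power of t, so this is
a fixed point equation for a map that contracts in the degree xdeg. *)
Lemma weierstrass_division w g :
  (forall i, (i < w)%N -> mscoef g (tX i) = 0) -> mscoef g (tX w) = 1 ->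
  forall h, exists q, forall m, (w <= m t)%N -> mscoef (h - q * g) m = 0.
Proof.
move=> g0 g1 h.
have [|v vE] := @mseries_unit _ (tquo w g); first by rewrite /= add0m.
pose e := tlow w g * v.
have e0 m : xdeg m = 0%N -> mscoef e m = 0.
  move=> m0; apply: mscoefM_eq0 => a b mE.
  have a0 : xdeg a = 0%N.
    by apply/eqP; move/eqP: m0; rewrite mE xdegD addn_eq0; case/andP.
  rewrite mscoef_tlow; case: ltnP => aw; last by rewrite mul0r.
  by rewrite (xdeg0P a0) g0 // mul0r.
have [|Q QE] := @contraction_fix _ (fun Q => tquo w h - tquo w (e * Q)) xdeg.
  move=> u u' N uu' m mN; rewrite !mscoefB; congr (_ - _).
  apply: (mscoefM_agree xdegD e0 uu').
  by rewrite xdegD xdeg_tX addn0.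
exists (Q * v) => m wm.
have -> : mscoef (h - Q * v * g) m =
  mscoef (tquo w (h - Q * v * g)) (mnm_sub m (tX w)) by rewrite /= le_tX.
have -> : Q * v * g = e * Q + T ^+ w * Q.
  have {1}-> : g = tlow w g + T ^+ w * tquo w g by rewrite subrK.
  rewrite mulrDr /e; congr (_ + _); first by ring.
  have -> : Q * v * (T ^+ w * tquo w g) = T ^+ w * Q * (tquo w g * v) by ring.
  by rewrite vE mulr1.
by rewrite opprD addrA !tquoB QE tquoXM subrr.
Qed.

Lemma tlow_sum w u : (forall m, (w <= m t)%N -> mscoef u m = 0) ->
  exists r : 'I_w -> mseries n 'F_2,
    u = \sum_(i < w) lift_series (r i) * T ^+ i.
Proof.
move=> u0; exists (fun i => MSeries (fun c => mscoef u (mext c i))).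
apply: mseriesP => m; rewrite -(mext_restr m); set a := mrestr m.
set k := m t; rewrite mscoef_sum.
have E (i : 'I_w) (f : mseries n 'F_2) : mscoef (lift_series f * T ^+ i) (mext a k) =
    if k == i then mscoef f a else 0.
  rewrite mulrC mscoef_varXM mext_max; case: leqP => [ik|ki]; last by rewrite ltn_eqF.
  have -> : mnm_sub (mext a k) (tX i) = mext a (k - i).
    have -> : mext a k = mnm_add (mext a (k - i)) (tX i).
      by rewrite -mext0n -mextD addm0 subnK.
    by rewrite addmK.
  by rewrite mscoef_lift subn_eq0 eqn_leq ik andbT.
under eq_bigr do rewrite E.
have [kw|wk] := ltnP k w.
  rewrite (bigD1 (Ordinal kw)) //= eqxx big1 ?addr0 // => i iN.
  by case: eqP => // kE; case/eqP: iN; apply/val_inj.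
rewrite u0 ?mext_max // big1 // => i _.
by rewrite gtn_eqF // (leq_trans _ wk).
Qed.

(** Division makes the series modulo g a module generated by 1, ..., t^(w-1) over the
series in the other variables; h is a root of the characteristic polynomial of its
multiplication matrix, by the adjugate trick. *)
Lemma weierstrass_integral w g :
  (forall i, (i < w)%N -> mscoef g (tX i) = 0) -> mscoef g (tX w) = 1 ->
  forall h, exists2 p : {poly mseries n 'F_2}, p \is monic &
    exists z, (map_poly (@lift_series n) p).[h] = z * g.
Proof.
move=> g0 g1 h; case: w => [|w] in g0 g1 *.
  (* If w = 0 then g is a unit, and 1 is a multiple of g. *)
  have [|v vE] := @mseries_unit _ g; first by rewrite -g1.
  exists 1; first exact: monic1.
  by exists v; rewrite rmorph1 hornerC mulrC vE.
have /choice[qr qrE] : forall i : 'I_w.+1,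
    exists qr : mseries n.+1 'F_2 * ('I_w.+1 -> mseries n 'F_2),
    h * T ^+ i = qr.1 * g + \sum_(j < w.+1) lift_series (qr.2 j) * T ^+ j.
  move=> i; have [q qE] := weierstrass_division g0 g1 (h * T ^+ i).
  have [r rE] := tlow_sum qE.
  by exists (q, r); rewrite -rE addrC subrK.
pose M := \matrix_(i < w.+1, j < w.+1) (qr i).2 j.
pose N := h%:M - map_mx (@lift_series n) M.
pose tau := \col_(j < w.+1) T ^+ j.
pose q := \col_(i < w.+1) ((qr i).1 * g).
have NE : N *m tau = q.
  apply/colP => i; rewrite mulmxBl mul_scalar_mx !mxE qrE.
  rewrite [X in _ - X](_ : _ =
    \sum_(j < w.+1) lift_series ((qr i).2 j) * T ^+ j) ?addrK //.
  by apply: eq_bigr => j _; rewrite !mxE.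
exists (char_poly M); first exact: char_poly_monic.
have -> : (map_poly (@lift_series n) (char_poly M)).[h] = \det N.
  pose phi : {rmorphism {poly mseries n 'F_2} -> mseries n.+1 'F_2} :=
    (horner_eval h \o map_poly (@lift_series n)).
  rewrite -[LHS]/(phi (char_poly M)) /char_poly -det_map_mx; congr (\det _).
  apply/matrixP => i j; rewrite !mxE /phi /= rmorphB rmorphMn /= map_polyX map_polyC /=.
  by rewrite /horner_eval hornerD hornerMn hornerN hornerX hornerC.
have : \adj N *m (N *m tau) = \adj N *m q by rewrite NE.
rewrite mulmxA mul_adj_mx mul_scalar_mx => /matrixP/(_ 0 0).
rewrite !mxE expr0 mulr1 => ->.
exists (\sum_j (\adj N) 0 j * (qr j).1); rewrite mulr_suml.
by apply: eq_bigr => j _; rewrite [q _ _]mxE mulrA.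
Qed.
End Weierstrass.

(** * Making a series regular in the last variable *)

Section Weights.

Definition mweight n (c m : multinom n) := (\sum_i c i * m i)%N.

Lemma mweight_ext n (c a : multinom n) k l :
  mweight (mext c k) (mext a l) = (mweight c a + k * l)%N.
Proof.
rewrite /mweight big_ord_recr /= !mext_max; congr (_ + _)%N.
by apply: eq_bigr => i _; rewrite !mext_widen.
Qed.

Lemma mweightMn n (c a : multinom n) k :
  mweight (mnm_muln c k) a = (k * mweight c a)%N.
Proof.
rewrite /mweight big_distrr; apply: eq_bigr => i _ /=.
by rewrite mulmnE mulnAC mulnC mulnA.
Qed.

Lemma nat_ex_min (P : nat -> Prop) : (exists k, P k) ->
  exists2 k, P k & forall j, P j -> (k <= j)%N.
Proof.
move=> exP; have exb : exists k, `[< P k >].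
  by case: exP => k ?; exists k; apply/asboolP.
have [k /asboolP kP kmin] := ex_minnP exb.
by exists k => // j jP; apply: kmin; apply/asboolP.
Qed.

Definition separates n (S : multinom n -> Prop) (c a : multinom n) :=
  [/\ S a, forall i, (0 < c i)%N &
      forall b, S b -> b <> a -> (mweight c a < mweight c b)%N].

(** Multiplying the weights of the first n variables by more than the least last exponent
k above a makes them decide first; the last variable of weight 1 only breaks ties. *)
Lemma separates_step n (S : multinom n.+1 -> Prop) c a :
  separates (fun b => exists k, S (mext b k)) c a ->
  exists C k, separates S (mext (mnm_muln c C.+1) 1) (mext a k).
Proof.
move=> [aS c0 cmin]; have [k kS kmin] := nat_ex_min aS.
exists k, k; split => // [i|b bS bN].
  by case: (ordSP i) => [j|]; rewrite ?mext_max // mext_widen mulmnE muln_gt0 c0.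
move: bS bN; rewrite -(mext_restr b); move: (mrestr b) (b ord_max) => b' l.
rewrite !mweight_ext !mweightMn !mul1n => bS bN.
have [b'a|b'a] := pselect (b' = a).
  rewrite b'a in bS bN *; rewrite ltn_add2l ltn_neqAle kmin // andbT.
  by apply/eqP => kl; apply: bN; rewrite kl.
have /cmin/(_ b'a) ab : exists l, S (mext b' l) by exists l.
apply: (@leq_trans (k.+1 * mweight c b')); last exact: leq_addr.
apply: (@leq_trans (k.+1 * (mweight c a).+1)); last by rewrite leq_mul2l ab.
by rewrite mulnS addnC ltn_add2r.
Qed.

Lemma ex_separates n (S : multinom n -> Prop) : (exists a, S a) ->
  exists c a, separates S c a.
Proof.
elim: n S => [|n IH] S [a aS].
  exists mnm0, a; split=> [//|[]//|b _ []].
  by apply/mnmP => -[].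
have [|c [b cb]] := IH (fun b => exists k, S (mext b k)).
  by exists (mrestr a), (a ord_max); rewrite mext_restr.
have [C [k Ck]] := separates_step cb.
by exists (mext (mnm_muln c C.+1) 1), (mext b k).
Qed.

Lemma ex_separates1 n (S : multinom n.+1 -> Prop) : (exists a, S a) ->
  exists c a, separates S (mext c 1) a.
Proof.
move=> [a aS]; have [|c [b cb]] := @ex_separates n (fun b => exists k, S (mext b k)).
  by exists (mrestr a), (a ord_max); rewrite mext_restr.
have [C [k Ck]] := separates_step cb.
by exists (mnm_muln c C.+1), (mext b k).
Qed.
End Weights.

Section Shear.
Variable n : nat.
Local Notation t := (@ord_max n).
Local Notation T := (msvar 'F_2 t).
Local Notation wid := (widen_ord (leqnSn n)).
Local Notation tX w := (mnm_muln (mnm1 t) w).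
Variable c : multinom n.
Hypothesis c_gt0 : forall i, (0 < mext c 1 i)%N.

(** In characteristic 2 the automorphism x_i -> x_i + t^(c_i) is its own inverse. *)
Definition shear_img (i : 'I_n.+1) : mseries n.+1 'F_2 :=
  if insub (i : nat) is Some j then msvar 'F_2 i + T ^+ c j else T.

Lemma shear_img_wid i : shear_img (wid i) = msvar 'F_2 (wid i) + T ^+ c i.
Proof.
rewrite /shear_img insubT //= => i_n; congr (_ + T ^+ c _); exact/val_inj.
Qed.

Lemma shear_img_max : shear_img t = T.
Proof. by rewrite /shear_img insubF //= ltnn. Qed.

Lemma shear_img0 i : mscoef (shear_img i) mnm0 = 0.
Proof.
case: (ordSP i) => [j|]; last by rewrite shear_img_max mscoef0_var.
rewrite shear_img_wid mscoefD mscoef0_var add0r.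
have := c_gt0 (wid j); rewrite mext_widen; case: (c j) => // k _.
by rewrite exprS mscoef0M mscoef0_var mul0r.
Qed.

Definition shear := subst shear_img.

Lemma shear_invol : involutive shear.
Proof.
apply: (subst_invol shear_img0) => i.
have [s <- sv] := subst_hom shear_img0.
case: (ordSP i) => [j|]; last by rewrite shear_img_max sv shear_img_max.
rewrite shear_img_wid rmorphD rmorphXn !sv shear_img_wid shear_img_max.
by rewrite -addrA mseries_char2 addr0.
Qed.

(** Equality modulo the ideal of all variables but t. *)
Definition axis_eq (u v : mseries n.+1 'F_2) :=
  forall m, xdeg m = 0%N -> mscoef u m = mscoef v m.

Lemma axis_eqM u u' v v' :
  axis_eq u u' -> axis_eq v v' -> axis_eq (u * v) (u' * v').
Proof.
move=> uu' vv' m m0; apply: eq_bigr => k /eqP mE.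
have /eqP : xdeg (mnm_add k.1 k.2) = 0%N by rewrite -mE.
by rewrite xdegD addn_eq0 => /andP[/eqP k1 /eqP k2]; rewrite uu' ?vv'.
Qed.

Lemma axis_eqX u v k : axis_eq u v -> axis_eq (u ^+ k) (v ^+ k).
Proof. 
move=> uv; elim: k => [|k IH]; first by rewrite !expr0.
by rewrite !exprS; apply: axis_eqM.
Qed.

Lemma axis_eq_shear_mon a :
  axis_eq (mmap1 shear_img a) (T ^+ mweight (mext c 1) a).
Proof.
rewrite /mmap1 /mweight -prodrXr.
elim/big_ind2: _ => [//|*|i _]; first exact: axis_eqM.
rewrite exprM; apply: axis_eqX.
case: (ordSP i) => [j|]; last by rewrite shear_img_max mext_max expr1.
rewrite shear_img_wid mext_widen => m /xdeg0P mE.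
rewrite mscoefD msmonE /= [m == _](_ : _ = false) ?add0r //.
apply/eqP => /(congr1 (fun m : multinom n.+1 => m (wid j))).
by rewrite mE mulmnE !mnm1E eqxx -val_eqE /= gtn_eqF.
Qed.

(** On the t-axis the monomial x^b becomes a power of t of exponent its weight, so the
single monomial of g of minimal weight yields the first nonzero term. *)
Lemma shear_regular g a : separates (fun b => mscoef g b != 0) (mext c 1) a ->
  let w := mweight (mext c 1) a in
  (forall i, (i < w)%N -> mscoef (shear g) (tX i) = 0) /\
  mscoef (shear g) (tX w) = 1.
Proof.
move=> [ga _ amin] w.
have E i : mscoef (shear g) (tX i) =
    \sum_(b : bmultinom n.+1 i.+1) mscoef g b * (i == mweight (mext c 1) b)%:R.
  have im : (mdeg (tX i) < i.+1)%N by rewrite mdegMn mdeg1 mul1n.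
  rewrite (mscoef_subst shear_img0 g im); apply: eq_bigr => b _.
  rewrite axis_eq_shear_mon ?xdeg_tX // msmonE msmonX /=; congr (_ * _%:R).
  congr nat_of_bool; apply/eqP/eqP => [|iE]; last exact: congr1 iE.
  by move/(congr1 (fun m : multinom n.+1 => m t)); rewrite !mulmnE mnm1E eqxx !mul1n.
split=> [i iw|]; rewrite E.
  apply: big1 => b _; case: eqP => [iE|]; rewrite ?mulr0 // mulr1.
  apply/eqP/negPn/negP => /amin ab.
  have [ba|ba] := pselect (bmnm b = a).
    by rewrite ba in iE; rewrite iE ltnn in iw.
  by have := ltn_trans iw (ab ba); rewrite -iE ltnn.
have aw : (mdeg a < w.+1)%N.
  rewrite ltnS mdegE /w /mweight; apply: leq_sum => i _.
  by rewrite -[X in (X <= _)%N]mul1n leq_mul2r c_gt0 orbT.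
rewrite (bigD1 (BMultinom aw)) //= eqxx mulr1 big1 ?addr0.
  by rewrite [LHS]F2E ga.
move=> b bN; case: eqP => [wb|]; rewrite ?mulr0 // mulr1.
apply/eqP/negPn/negP => /amin ab.
have ba : bmnm b <> a by move=> ba; case/eqP: bN; apply/val_inj.
by have := ab ba; rewrite -wb ltnn.
Qed.

End Shear.

(** * Chains of primes in a power series ring *)

(** Prime ideals as predicates, which pull back along ring morphisms by composition. *)
Record prime_pred (A : comNzRingType) (P : A -> Prop) : Prop := PrimePred {
  prime_0 : P 0;
  prime_D : forall u v, P u -> P v -> P (u + v);
  prime_M : forall u v, P v -> P (u * v);
  prime_1 : ~ P 1;
  prime_prime : forall u v, P (u * v) -> P u \/ P v }.

Definition strict_sub (A : Type) (P Q : A -> Prop) :=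
  (forall x, P x -> Q x) /\ exists2 x, Q x & ~ P x.

Lemma prime_preim (A B : comNzRingType) (s : {rmorphism A -> B}) (P : B -> Prop) :
  prime_pred P -> prime_pred (fun a => P (s a)).
Proof.
move=> [P0 PD PM P1 PP]; split=> [|u v|u v||u v].
- by rewrite rmorph0.
- by rewrite rmorphD; apply: PD.
- by rewrite rmorphM; apply: PM.
- by rewrite rmorph1.
- by rewrite rmorphM; apply: PP.
Qed.

(** Incomparability in integral extensions: reading the equation of h from its constant
coefficient, the first coefficient outside P is still in P', since h is in P'. *)
Lemma incomparable (A B : comNzRingType) (s : {rmorphism A -> B}) (P P' : B -> Prop) h
    (p : {poly A}) : prime_pred P -> prime_pred P' -> (forall x, P x -> P' x) ->
  p \is monic -> P (map_poly s p).[h] -> P' h -> ~ P h ->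
  exists2 a, P' (s a) & ~ P (s a).
Proof.
move=> pP pP' PP' + + P'h Ph; elim/poly_ind: p => [|p a IH].
  by rewrite monicE lead_coef0 eq_sym oner_eq0.
have [->|p0] := eqVneq p 0.
  rewrite mul0r add0r monicE lead_coefC => /eqP ->.
  by rewrite rmorph1 hornerC => /(prime_1 pP).
have -> : (p * 'X + a%:P \is monic) = (p \is monic).
  rewrite !monicE lead_coefDl ?lead_coefMX // size_polyC size_mulX //.
  by case: (a != 0); rewrite // ltnS size_poly_gt0.
move=> pm; rewrite rmorphD rmorphM /= map_polyX map_polyC /=.
rewrite hornerD hornerMX hornerC => PE.
have P'M : P' ((map_poly s p).[h] * h) by apply: (prime_M pP').
have P'a : P' (s a).
  have := prime_D pP' (PP' _ PE) (prime_M pP' (-1) P'M).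
  by rewrite mulN1r addrAC subrr add0r.
have [Pa|Pa] := pselect (P (s a)); last by exists a.
have : P ((map_poly s p).[h] * h).
  have := prime_D pP PE (prime_M pP (-1) Pa).
  by rewrite mulN1r addrK.
by case/(prime_prime pP) => // /(IH pm).
Qed.

Lemma strict_sub_neq0 (A : comNzRingType) (P Q : A -> Prop) : prime_pred P ->
  strict_sub P Q -> exists2 x, Q x & x <> 0.
Proof. by move=> /prime_0 P0 [_ [x Qx Px]]; exists x => // x0; rewrite x0 in Px. Qed.

Lemma mseries_neq0 n (g : mseries n 'F_2) :
  g <> 0 -> exists m, mscoef g m != 0.
Proof.
move=> g0; apply: contrapT => gm; apply: g0; apply: mseriesP => m.
by apply/eqP/negPn/negP => gm0; apply: gm; exists m.
Qed.

(** Of the first inclusion of the chain only a nonzero series g of P 1 is kept. Once g is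
regular, the primes from P 1 on restrict to a chain in one variable less. *)
Lemma prime_chain_bound n (l : nat) (P : nat -> mseries n 'F_2 -> Prop) :
  (forall i, (i <= l)%N -> prime_pred (P i)) ->
  (forall i, (i < l)%N -> strict_sub (P i) (P i.+1)) -> (l <= n)%N.
Proof.
elim: n l P => [|n IH] [//|l] P pP PS; have [g Pg g0] :=
    strict_sub_neq0 (pP 0%N isT) (PS 0%N isT); have [m gm] := mseries_neq0 g0.
  have [|v gv] := @mseries_unit _ g.
    by rewrite [LHS]F2E; have -> : mnm0 = m; [apply/mnmP => -[]|rewrite gm].
  case: (prime_1 (pP 1%N isT)).
  by rewrite -gv mulrC; apply: prime_M => //; apply: pP.
have [|c [a ca]] := @ex_separates1 n (fun b => mscoef g b != 0); first by exists m.
have c0 : forall i, (0 < mext c 1 i)%N by case: ca.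
have [reg0 reg1] := shear_regular c0 ca.
have [s sE _] := subst_hom (shear_img0 c0).
have ss : involutive s by rewrite sE; apply: shear_invol.
apply: (IH l (fun i f => P i.+1 (s (lift_series f)))) => i il.
  have := prime_preim (@lift_series n) (prime_preim s (pP i.+1 il)).
  exact.
have [sub [h Ph Ph']] := PS i.+1 il.
split=> [f|]; first exact: sub.
have [p pm [z zE]] := weierstrass_integral reg0 reg1 (s h).
have pPi := prime_preim s (pP i.+1 (ltnW il)).
have pPi1 := prime_preim s (pP i.+2 il).
apply: (incomparable (h := s h) pPi pPi1 (fun x => sub (s x)) pm); rewrite ?ss //.
rewrite zE rmorphM /= -[shear _ _]/(subst _ _) -sE ss.
apply: prime_M; first exact: (pP i.+1 (ltnW il)).
elim: i il {sub h Ph Ph' zE pPi pPi1} => [//|i IHi] il.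
by have [sub _] := PS i.+1 (ltnW il); apply: sub; apply: IHi (ltnW il).
Qed.

(** * A chain of primes in a hypersurface *)

Section Faces.
Variable n : nat.
Implicit Types (u v : mseries n 'F_2) (m a b : multinom n) (K : pred 'I_n).

Definition on_face K m := forall i, K i -> m i = 0%N.
(** The ideal generated by the variables in K, described by its monomials. *)
Definition face_ideal K u := forall m, on_face K m -> mscoef u m = 0.

Lemma on_faceD K a b : on_face K (mnm_add a b) -> on_face K a /\ on_face K b.
Proof.
move=> ab; split=> i Ki; have /eqP := ab i Ki;
  by rewrite mnmDE addn_eq0 => /andP[/eqP ? /eqP ?].
Qed.

Lemma ex_min_mon (S : multinom n -> Prop) : (exists a, S a) ->
  exists2 a, S a & forall b, S b -> (a <= b)%O.
Proof.
move=> [a aS]; apply: contrapT => noMin.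
elim/(well_founded_ind (@ltom_wf n)): a aS => a IH aS.
apply: noMin; exists a => // b bS; rewrite leNgt; apply/negP => ba.
exact: (IH b ba bS).
Qed.

Lemma face_ideal_min K u : ~ face_ideal K u -> exists a,
  [/\ on_face K a, mscoef u a != 0 &
      forall b, on_face K b -> (b < a)%O -> mscoef u b = 0].
Proof.
move=> uK; have [|a [aK ua] amin] :=
  @ex_min_mon (fun a => on_face K a /\ mscoef u a != 0).
  apply: contrapT => no; apply: uK => m mK; apply/eqP/negPn/negP => um.
  by apply: no; exists m.
exists a; split => // b bK; rewrite ltNge => /negP ba.
by apply/eqP/negPn/negP => ub; apply: ba; apply: amin.
Qed.

(** If u and v have least monomials a and b on the face, then a + b occurs in u v: another
decomposition of a + b on the face has a part below a or below b. *)
Lemma face_ideal_prime K : prime_pred (face_ideal K).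
Proof.
split=> [m _ //|u v uK vK m mK|u v vK m mK|/(_ mnm0)|u v uvK].
- by rewrite mscoefD uK ?vK ?addr0.
- apply: mscoefM_eq0 => a b mE; rewrite mE in mK.
  by have [_ bK] := on_faceD mK; rewrite vK ?mulr0.
- rewrite mscoef1 eqxx => /(_ (fun i _ => mnm0E i)) /eqP.
  by rewrite oner_eq0.
- have [?|uK] := pselect (face_ideal K u); [by left|right].
  apply: contrapT => vK.
  have [a [aK ua amin]] := face_ideal_min uK.
  have [b [bK vb bmin]] := face_ideal_min vK.
  have abK : on_face K (mnm_add a b).
    by move=> i Ki; rewrite mnmDE aK ?bK.
  have := uvK _ abK; rewrite mscoefM1 => [/eqP|a' b' abE a'N].
    by rewrite mulf_eq0 (negbTE ua) (negbTE vb).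
  move: abK; rewrite abE => /on_faceD[a'K b'K].
  have [a'a|aa'|a'E] := ltgtP a' a; last by rewrite a'E eqxx in a'N.
    by rewrite amin ?mul0r.
  rewrite (bmin b') ?mulr0 // ltNge; apply/negP => bb'.
  have := ltmc_le_add aa' bb'.
  by rewrite abE ltxx.
Qed.
End Faces.

Lemma mseries_mulf_eq0 n (u v : mseries n 'F_2) : u * v = 0 -> u = 0 \/ v = 0.
Proof.
have E w : face_ideal pred0 w <-> w = 0 :> mseries n 'F_2.
  by split=> [w0|-> //]; apply: mseriesP => m; apply: w0.
by move=> /E /(prime_prime (face_ideal_prime pred0))[/E ?|/E ?]; [left|right].
Qed.

Section CurveChain.
Variables (d : nat) (f g0 : mseries d.+1 'F_2).
Hypothesis d_gt0 : (0 < d)%N.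
Hypothesis g00 : mscoef g0 mnm0 = 0.
Local Notation x := (xvar d).

(** A chart of the blowup of the origin, with x_0 sent to a series g0 that will be chosen
so that f vanishes. *)
Definition blowup_img (i : 'I_d.+1) : mseries d.+1 'F_2 :=
  if i == 0%N :> nat then g0 else if i == 1%N :> nat then x 1 else x 1 * x i.

Lemma blowup_img0 i : mscoef (blowup_img i) mnm0 = 0.
Proof.
by rewrite /blowup_img; do 2!case: ifP => // _;
  rewrite ?mscoef0M ?mscoef0_var ?mul0r.
Qed.

Hypothesis f_blowup : forall s : {rmorphism mseries d.+1 'F_2 -> mseries d.+1 'F_2},
  s (x 0) = g0 -> s (x 1) = x 1 ->
  (forall i, (1 < i <= d)%N -> s (x i) = x 1 * x i) -> s f = 0.

(** The primes are the preimages of (x_d), (x_(d-1), x_d), ..., (x_1, ..., x_d) preceded by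
that of 0. The variable x_(d-j) distinguishes the j-th from the next one. *)
Lemma hypersurface_chain : exists P : nat -> mseries d.+1 'F_2 -> Prop,
  (forall i, prime_pred (P i) /\ P i f) /\
  forall i, (i < d)%N -> strict_sub (P i) (P i.+1).
Proof.
have [s _ sv] := subst_hom blowup_img0.
have x0 : s (x 0) = g0 by rewrite sv /blowup_img inordK.
have x1 : s (x 1) = x 1 by rewrite sv /blowup_img inordK.
have xi i : (1 < i <= d)%N -> s (x i) = x 1 * x i.
  case/andP=> i1 id; by rewrite sv /blowup_img inordK // !gtn_eqF //; exact: ltnW.

have sf := f_blowup x0 x1 xi.
exists (fun j u => face_ideal (fun i : 'I_d.+1 => d - j < i)%N (s u)); split=> [j|j jd].
  split; last by rewrite sf => m _.
  exact: (prime_preim s (face_ideal_prime _)).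
split=> [u uj m mK|].
  by apply: uj => i ji; apply: mK; apply: leq_ltn_trans ji; rewrite leq_sub2l.
(* The image of x_(d-j) is x_1 if d - j = 1, and x_1 x_(d-j) otherwise. *)
have [a [aE ai al]] : exists a : multinom d.+1, [/\ s (x (d - j)) = msmon a,
    (0 < a (inord (d - j)))%N & forall l : 'I_d.+1, (d - j < l)%N -> a l = 0%N].
  have [dj1|dj1] := eqVneq (d - j)%N 1%N.
    exists (mnm1 (inord 1)); rewrite dj1 x1; split=> //; first by rewrite mnm1E eqxx.
    by move=> l l1; rewrite mnm1E -val_eqE /= inordK // ltn_eqF.
  have dj : (1 < d - j <= d)%N.
    by rewrite leq_subr andbT ltn_neqAle eq_sym dj1 subn_gt0.
  exists (mnm_add (mnm1 (inord 1)) (mnm1 (inord (d - j)))); split.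
  - by rewrite xi // msmonD.
  - by rewrite mnmDE !mnm1E eqxx addn1.
  - move=> l jl; rewrite mnmDE !mnm1E -!val_eqE /= !inordK ?ltnS ?leq_subr //.
    by rewrite !ltn_eqF // (leq_ltn_trans _ jl) //; case/andP: dj => /ltnW.
exists (x (d - j)); rewrite aE.
  move=> m mK; rewrite /=; case: eqP => // mE; move: ai; rewrite -mE mK //.
  by rewrite inordK ?ltnS ?leq_subr // subnS prednK ?subn_gt0.
by move=> /(_ a al) /eqP; rewrite /= eqxx oner_eq0.
Qed.
End CurveChain.

Lemma nat_max_eq (P : classical_sets.set nat) n :
  P n -> (forall k, P k -> (k <= n)%N) -> nat_max P = n.
Proof.
move=> Pn Pmax; rewrite /nat_max.
case: classical_sets.xgetP => [k _ [Pk kmax]|/(_ n) []//].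
by apply/eqP; rewrite eqn_leq Pmax // kmax.
Qed.

Section MkPrime.
Variables (A : comNzRingType) (P : A -> Prop) (pP : prime_pred P).
Let Pb : {pred A} := fun a => `[< P a >].
Fact prime_pred_ideal : idealr_closed Pb.
Proof.
split; first exact/asboolP/(prime_0 pP).
  by apply/asboolP; apply: prime_1 pP.
move=> a u v /asboolP Pu /asboolP Pv; apply/asboolP.
by apply: (prime_D pP) => //; apply: (prime_M pP).
Qed.
Fact prime_pred_prime : prime_idealr_closed Pb.
Proof.
move=> u v /asboolP /(prime_prime pP)[?|?]; apply/orP; [left|right]; exact/asboolP.
Qed.
Lemma prime_pred_idealr : exists I : prime_idealr A, forall a, a \in I <-> P a.
Proof.
pose B1 := isIdealr.Build A Pb prime_pred_ideal.
pose B2 := isPrimeIdealrClosed.Build A Pb prime_pred_prime.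
pose I : prime_idealr A := HB.pack Pb B1 B2.
by exists I => a; split=> [/asboolP|?] //; apply/asboolP.
Qed.
End MkPrime.

Section KrullDim.
Variables (d : nat) (f : mseries d.+1 'F_2) (A : comNzRingType).
Variable pr : {rmorphism mseries d.+1 'F_2 -> A}.
Hypothesis pr_surj : forall a, exists u, pr u = a.
Hypothesis pr_ker : forall u, pr u = 0 <-> exists h, u = h * f.
Hypothesis f_neq0 : f <> 0.

(** Chains of primes of A are chains of primes of the power series ring that contain f.
As f <> 0, the prime 0 can be added below them; thus their length is at most d. *)
Lemma krull_dim_hypersurface (P : nat -> mseries d.+1 'F_2 -> Prop) :
  (forall i, prime_pred (P i) /\ P i f) ->
  (forall i, (i < d)%N -> strict_sub (P i) (P i.+1)) -> krull_dim A = d.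
Proof.
move=> Pp Ps; apply: nat_max_eq => [|k [Q Qs]].
  pose P' i a := exists2 u, pr u = a & P i u.
  have PE i u : P' i (pr u) <-> P i u.
    split=> [[v vu Pv]|Pu]; last by exists u.
    have /pr_ker[h hE] : pr (u - v) = 0 by rewrite rmorphB vu subrr.
    rewrite -[u](subrK v) hE; have [pP Pf] := Pp i.
    by apply: prime_D => //; apply: prime_M.
  have pP' i : prime_pred (P' i).
    have [pP Pf] := Pp i; split.
    - by rewrite -(rmorph0 pr); apply/PE; apply: prime_0.
    - move=> a b; have [[u <-] [v <-]] := (pr_surj a, pr_surj b).
      by rewrite -rmorphD !PE; apply: prime_D.
    - move=> a b; have [[u <-] [v <-]] := (pr_surj a, pr_surj b).
      by rewrite -rmorphM !PE; apply: prime_M.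
    - by rewrite -(rmorph1 pr) PE; apply: prime_1.
    - move=> a b; have [[u <-] [v <-]] := (pr_surj a, pr_surj b).
      by rewrite -rmorphM !PE; apply: prime_prime.
  have /choice[Q QE] : forall i, exists I : prime_idealr A,
      forall a, a \in I <-> P' i a.
    by move=> i; apply: prime_pred_idealr.
  exists Q => i /Ps[sub [u Pu Pu']]; split=> [a /QE|/(_ (pr u))].
    by have [v <-] := pr_surj a; move=> /PE /sub /PE /QE.
  by move=> /(_ _)/wrap[|/QE/PE//]; apply/QE/PE.
pose P' i := if i is j.+1 then fun u => pr u \in Q j else fun u => u = 0.
apply: (@prime_chain_bound d.+1 k.+1 P') => [[|i] _|[|i]] /=.
- split=> [//|u v -> ->|u v ->|/eqP|u v]; rewrite ?addr0 ?mulr0 //.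
    by rewrite oner_eq0.
  exact: mseries_mulf_eq0.
- split=> [|u v|u v||u v]; rewrite ?rmorph0 ?rmorph1 ?rmorphD ?rmorphM.
  + exact: rpred0.
  + exact: rpredD.
  + by move=> vQ; apply: idealMr.
  + by apply/negP; rewrite idealr1.
  + by rewrite prime_idealrM => /orP.
- move=> _; split=> [u ->|]; first by rewrite rmorph0 rpred0.
  exists f => //; have -> : pr f = 0; last exact: rpred0.
  by apply/pr_ker; exists 1; rewrite mul1r.
- rewrite ltnS => /Qs[sub nsub]; split=> [u /sub //|].
  apply: contrapT => no; apply: nsub => a.
  have [u <-] := pr_surj a => uQ; apply: contrapT => uQ'.
  by apply: no; exists u.
Qed.
End KrullDim.

(** * Kernels of the powers of an endomorphism *)

Section KernelDims.
Variables (k : fieldType) (V : vectType k) (phi : 'End(V)).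

Lemma dim_preim (U U' : {vspace V}) : (forall x, (x \in U') = (phi x \in U)) ->
  \dim U' = (\dim (lker phi) + \dim (U :&: limg phi))%N.
Proof.
move=> UU'; rewrite -(limg_ker_dim phi U').
have /capv_idPr -> : (lker phi <= U')%VS.
  by apply/subvP => x; rewrite memv_ker UU' => /eqP ->; apply: mem0v.
congr (_ + \dim _)%N; apply/vspaceP => y; rewrite memv_cap; apply/idP/andP.
  case/memv_imgP => x; rewrite UU' => xU ->; split=> //.
  by apply: memv_img; apply: memvf.
by case=> yU /memv_imgP[x _ yE]; rewrite yE memv_img // UU' -yE.
Qed.

(** For U1 = ker phi^k this is the concavity of k |-> dim ker phi^k: the difference
dim ker phi^(k+1) - dim ker phi^k decreases, since phi injects each quotient of
successive kernels into the previous one. *)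
Lemma dim_preim_concave (U1 U2 U3 : {vspace V}) : (U1 <= U2)%VS ->
  (forall x, (x \in U2) = (phi x \in U1)) -> (forall x, (x \in U3) = (phi x \in U2)) ->
  (\dim U3 + \dim U1 <= (\dim U2).*2)%N.
Proof.
move=> U12 /dim_preim E2 /dim_preim E3; rewrite -addnn {1}E3 [in X in (_ <= X + _)%N]E2.
rewrite -!addnA leq_add2l; set I := limg phi.
have <- : ((U2 :&: I) :&: U1 = U1 :&: I)%VS.
  by rewrite [LHS]capvC capvA (capv_idPl U12).
rewrite -dimv_sum_cap addnC leq_add2l; apply: dimvS.
by rewrite subv_add capvSl.
Qed.

(** The inequality dim ker phi^2 <= 2 dim ker phi is strict unless the kernel is in the
image, that is unless there is no Jordan block of size 1. *)
Lemma dim_ker_sq_lt (U2 : {vspace V}) u : phi u = 0 -> u \notin limg phi ->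
  (forall x, (x \in U2) = (phi (phi x) == 0)) -> (\dim U2 < (\dim (lker phi)).*2)%N.
Proof.
move=> pu ui U2E; rewrite (@dim_preim (lker phi)); last first.
  by move=> x; rewrite memv_ker U2E.
rewrite -addnn ltn_add2l ltn_neqAle dimvS ?capvSl // andbT.
apply: contraNneq ui => dE; have uk : u \in lker phi by rewrite memv_ker pu.
have : (lker phi :&: limg phi == lker phi)%VS by rewrite eqEdim capvSl dE leqnn.
by move=> /eqP kE; move: uk; rewrite -kE memv_cap => /andP[].
Qed.
End KernelDims.

(** * The box modules *)

Section Box.
Variables n q : nat.
Implicit Types (f g h : mseries n 'F_2) (m a : multinom n).

(** The quotient of the power series ring by (x_1^q, ..., x_n^q), in its monomial basis. *)
Definition box := {ffun 'I_n -> 'I_q}.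
Definition boxmod := {ffun box -> ('F_2)^o}.
Implicit Types (b : box) (v w : boxmod).
HB.instance Definition _ := Finite.on boxmod.
HB.instance Definition _ := Vector.on boxmod.

Definition mbox b : multinom n := Multinom (mktuple (fun i => b i : nat)).
Definition in_box m := [forall i, (m i < q)%N].

Lemma mbox_inj : injective mbox.
Proof.
move=> b c /mnmP bc; apply/ffunP => i; apply/val_inj.
by have := bc i; rewrite !mnmE.
Qed.

Lemma mboxE b i : mbox b i = b i. Proof. by rewrite mnmE. Qed.

Lemma in_mbox b : in_box (mbox b).
Proof. by apply/forallP => i; rewrite mboxE ltn_ord. Qed.

Lemma in_boxP m : in_box m -> exists b, m = mbox b.
Proof.
move=> /forallP mq; exists [ffun i => Ordinal (mq i)].
by apply/mnmP => i; rewrite mboxE ffunE.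
Qed.

Lemma in_boxS m a : in_box (mnm_add a m) -> in_box m.
Proof.
move/forallP => am; apply/forallP => i; apply: leq_ltn_trans (am i).
by rewrite mnmDE leq_addl.
Qed.

Definition bproj f : boxmod := [ffun b => mscoef f (mbox b)].
Definition bsec v : mseries n 'F_2 :=
  MSeries (fun m => if [pick b | mbox b == m] is Some b then v b else 0).
Definition act f v := bproj (f * bsec v).

Lemma bsecE v b : mscoef (bsec v) (mbox b) = v b.
Proof.
rewrite /=; case: pickP => [c /eqP/mbox_inj -> //|/(_ b)].
by rewrite eqxx.
Qed.

Lemma bsec_out v m : ~~ in_box m -> mscoef (bsec v) m = 0.
Proof. by rewrite /=; case: pickP => // b /eqP <-; rewrite in_mbox. Qed.

Lemma bsecK v : bproj (bsec v) = v.
Proof. by apply/ffunP => b; rewrite ffunE bsecE. Qed.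

Lemma bprojK f m : in_box m -> mscoef (bsec (bproj f)) m = mscoef f m.
Proof. by case/in_boxP => b ->; rewrite bsecE ffunE. Qed.

Lemma bprojD f g : bproj (f + g) = bproj f + bproj g.
Proof. by apply/ffunP => b; rewrite !ffunE. Qed.

Lemma bproj0 : bproj 0 = 0.
Proof. by apply/ffunP => b; rewrite !ffunE. Qed.

Lemma bprojP f g :
  (forall m, in_box m -> mscoef f m = mscoef g m) <-> bproj f = bproj g.
Proof.
split=> [fg|fg m /in_boxP[b ->]]; last by move/ffunP: fg => /(_ b); rewrite !ffunE.
by apply/ffunP => b; rewrite !ffunE fg // in_mbox.
Qed.

Lemma bprojM f g : bproj (f * g) = act f (bproj g).
Proof.
apply/bprojP => m mb; apply: eq_bigr => k /eqP mE; congr (_ * _).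
by rewrite bprojK // (@in_boxS _ k.1) // -mE.
Qed.

Lemma actM f g v : act (f * g) v = act f (act g v).
Proof. by rewrite [LHS]/act -mulrA bprojM. Qed.

Lemma act1 v : act 1 v = v. Proof. by rewrite /act mul1r bsecK. Qed.

Lemma actD f g v : act (f + g) v = act f v + act g v.
Proof. by rewrite /act mulrDl bprojD. Qed.

Lemma act0 v : act 0 v = 0.
Proof. by apply/ffunP => b; rewrite /act mul0r !ffunE. Qed.

Lemma act_sum (I : Type) (r : seq I) P (F : I -> mseries n 'F_2) v :
  act (\sum_(i <- r | P i) F i) v = \sum_(i <- r | P i) act (F i) v.
Proof. by apply: (big_morph (act^~ v)) => [f g|]; rewrite ?actD ?act0. Qed.

Fact act_linear f : linear (act f).
Proof.
move=> c v w; apply/ffunP => b; rewrite !ffunE.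
have -> : f * bsec (c *: v + w) = msC n c * (f * bsec v) + f * bsec w.
  rewrite mulrCA -mulrDr; congr (_ * _); apply: mseriesP => m.
  rewrite mscoefD mscoef_CM; have [/in_boxP[d ->]|mN] := boolP (in_box m).
    by rewrite !bsecE !ffunE.
  by rewrite !bsec_out // mulr0 addr0.
by rewrite mscoefD mscoef_CM.
Qed.
HB.instance Definition _ f := GRing.isLinear.Build 'F_2 boxmod boxmod *:%R (act f)
  (act_linear f).

(** The kernel has the dimension of the cokernel, which is the colength of the ideal
(f, x_1^q, ..., x_n^q); kernels are easier to split into pieces than cokernels. *)
Definition kerdim f := \dim (lker (linfun (act f))).

Lemma mem_ker f v : (v \in lker (linfun (act f))) = (act f v == 0).
Proof. by rewrite memv_ker lfunE. Qed.

Lemma kerP f v : reflect (act f v = 0) (v \in lker (linfun (act f))).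
Proof. by rewrite mem_ker; apply: eqP. Qed.

Lemma card_ker f : #|[set v | act f v == 0]| = (2 ^ kerdim f)%N.
Proof.
rewrite -[X in (X ^ _)%N](@card_Fp 2) // -card_vspace; apply: eq_card => v.
by rewrite inE mem_ker.
Qed.

Lemma kerdim_concave f k :
  (kerdim (f ^+ k.+2) + kerdim (f ^+ k) <= (kerdim (f ^+ k.+1)).*2)%N.
Proof.
apply: (@dim_preim_concave _ _ (linfun (act f))) => [|v|v].
- apply/subvP => v /kerP fv; apply/kerP.
  by rewrite exprS actM fv linear0.
- by rewrite lfunE /= !mem_ker exprSr actM.
- by rewrite lfunE /= !mem_ker exprSr actM.
Qed.

Lemma kerdim1 : kerdim 1 = 0%N.
Proof.
apply/eqP; rewrite /kerdim dimv_eq0; apply/eqP/vspaceP => v.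
by rewrite mem_ker act1 memv0.
Qed.

Lemma kerdim_sq_lt f u : act f u = 0 -> (forall v, act f v <> u) ->
  (kerdim (f ^+ 2) < (kerdim f).*2)%N.
Proof.
move=> fu uN; apply: (@dim_ker_sq_lt _ _ (linfun (act f)) _ u); first by rewrite lfunE.
  by apply/memv_imgP => -[v _]; rewrite lfunE => /esym /uN.
by move=> v; rewrite !lfunE /= mem_ker expr2 actM.
Qed.

Lemma card_box : #|{: boxmod}| = (2 ^ (q ^ n))%N.
Proof. by rewrite card_ffun card_ffun !card_ord. Qed.

Lemma kerdim_max f : (kerdim f <= q ^ n)%N.
Proof.
rewrite -(leq_exp2l _ _ (ltnSn 1)) -card_ker -card_box; exact: max_card.
Qed.

Lemma kerdim0 f : (forall v, act f v = 0) -> kerdim f = (q ^ n)%N.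
Proof.
move=> f0; apply/eqP; rewrite -(eqn_exp2l _ _ (ltnSn 1)) -card_ker -card_box.
by apply/eqP; apply: eq_card => v; rewrite !inE f0 eqxx.
Qed.

Lemma kerdim_mono f g : (forall v, act f v = 0 -> act g v = 0) ->
  (kerdim f <= kerdim g)%N.
Proof.
move=> fg; apply: dimvS; by apply/subvP => v /kerP /fg gv; apply/kerP.
Qed.

Lemma act_varX i v : act (msvar 'F_2 i ^+ q) v = 0.
Proof.
apply/ffunP => b; rewrite !ffunE mscoef_varXM mboxE leqNgt ltn_ord //.
Qed.

End Box.
Arguments kerdim {n} q%_N f%_R.

(** A series without monomials in the box lies in (x_1^q, ..., x_n^q): assign each monomial
to the first variable whose exponent is at least q. *)
Lemma bproj0_gen n q (g : mseries n 'F_2) : bproj q g = 0 ->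
  exists c : 'I_n -> mseries n 'F_2, g = \sum_i msvar 'F_2 i ^+ q * c i.
Proof.
move=> g0; have {}g0 m : in_box q m -> mscoef g m = 0.
  by case/in_boxP => b ->; move/ffunP: g0 => /(_ b); rewrite !ffunE.
pose first m (i : 'I_n) := [forall j : 'I_n, (j < i)%N ==> (m j < q)%N].
pose e i : multinom n := mnm_muln (mnm1 i) q.
have eE i j : e i j = ((i == j) * q)%N by rewrite mulmnE mnm1E.
exists (fun i => MSeries (fun m : multinom n =>
  if first m i then mscoef g (mnm_add m (e i)) else 0)).
apply: mseriesP => m; rewrite mscoef_sum.
have E (i : 'I_n) : (q <= m i)%N ->
    mnm_add (mnm_sub m (e i)) (e i) = m /\ first (mnm_sub m (e i)) i = first m i.
  move=> qm; split; first rewrite submK //.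
    by apply/mnm_lepP => j; rewrite eE; case: eqP => [<-|]; rewrite ?mul1n.
  apply: eq_forallb => j; case: ltnP => //= ji.
  by rewrite mnmBE eE gt_eqF // mul0n subn0.
under eq_bigr do rewrite mscoef_varXM.
have [mb|] := boolP (in_box q m).
  rewrite g0 // big1 // => i _; case: leqP => // qm /=.
  by rewrite leqNgt (forallP mb i) in qm.
rewrite negb_forall => /existsP[i0]; rewrite -leqNgt => qi0.
have [i qi imin] := @arg_minnP _ i0 (fun i => q <= m i)%N (fun i => i : nat) qi0.
have fi : first m i.
  apply/forallP => j; apply/implyP => ji; rewrite ltnNge; apply/negP => /imin.
  by rewrite leqNgt ji.
rewrite (bigD1 i) //= big1 ?addr0.
  by rewrite qi; have [-> ->] := E i qi; rewrite fi.
move=> j jN; case: leqP => // qj; have [-> ->] := E j qj.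
case: ifP => // /forallP /(_ i) /implyP fj.
have := imin j qj; rewrite leq_eqVlt => /orP[/eqP ij|/fj]; last by rewrite ltnNge qi.
by case/eqP: jN; apply/val_inj.
Qed.

Lemma mscoef0_gen n (g : mseries n 'F_2) : mscoef g mnm0 = 0 ->
  exists c : 'I_n -> mseries n 'F_2, g = \sum_i msvar 'F_2 i * c i.
Proof.
move=> g0; have [|c gE] := @bproj0_gen n 1 g; last first.
  by exists c; rewrite {1}gE; under eq_bigr do rewrite expr1.
apply/ffunP => b; rewrite !ffunE (_ : mbox b = mnm0) //.
by apply/mnmP => i; rewrite mboxE mnm0E ord1.
Qed.

Lemma exprX2_sum (R : comNzRingType) (I : Type) (r : seq I) (F : I -> R) e :
  (forall x : R, x + x = 0) ->
  (\sum_(i <- r) F i) ^+ (2 ^ e) = \sum_(i <- r) F i ^+ (2 ^ e).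
Proof.
move=> R2.
have D (u v : R) : (u + v) ^+ (2 ^ e) = u ^+ (2 ^ e) + v ^+ (2 ^ e).
  elim: e => [|e IH]; first by rewrite !expr1.
  by rewrite expnSr !exprM IH sqrrD mulr2n R2 addr0.
elim: r => [|i r IH]; last by rewrite !big_cons D IH.
by rewrite !big_nil expr0n expn_eq0.
Qed.

(** * Composition series of the box modules *)

Section AdditiveSets.
Variables (V : finZmodType).
Hypothesis VV : forall v : V, v + v = 0.
Implicit Types S : {set V}.
Definition add_set S := 0 \in S /\ forall u v, u \in S -> v \in S -> u + v \in S.

Definition adjoin S v := S :|: [set v + u | u in S].

Lemma card_adjoin S v : add_set S -> v \notin S -> #|adjoin S v| = (2 * #|S|)%N.
Proof.
move=> [_ SD] vS; rewrite cardsU card_imset; last exact: addrI.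
rewrite mul2n -addnn [X in (_ - X)%N](_ : _ = 0%N) ?subn0 //.
apply/eqP; rewrite cards_eq0; apply/eqP/setP => w; rewrite !inE; apply/negP.
case/andP=> wS /imsetP[u uS wE]; case/negP: vS.
have -> : v = w + u by rewrite wE -addrA VV addr0.
exact: SD.
Qed.

(** Strict inclusions of subgroups of a group of exponent 2 at least double the size, so
cardinals measure lengths. *)
Lemma card_add_set_lt S S' v : add_set S -> add_set S' -> S \subset S' ->
  v \in S' -> v \notin S -> (2 * #|S| <= #|S'|)%N.
Proof.
move=> aS [_ S'D] SS' vS' vS; rewrite -(card_adjoin aS vS); apply: subset_leq_card.
apply/subsetP => w; rewrite !inE => /orP[/(subsetP SS')//|/imsetP[u uS ->]].
by apply: S'D => //; apply: (subsetP SS').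
Qed.
End AdditiveSets.

Section BoxSubmodules.
Variables (n q : nat) (f : mseries n 'F_2).
Local Notation V := (boxmod n q).
Implicit Types (S : {set V}) (v w : V) (g : mseries n 'F_2).

Lemma boxmod_char2 v : v + v = 0.
Proof. by apply/ffunP => b; rewrite !ffunE [v b]F2E; case: (_ != 0); apply/val_inj. Qed.

Definition submod_set S :=
  [/\ 0 \in S, forall u v, u \in S -> v \in S -> u + v \in S &
      forall g v, v \in S -> act g v \in S].

Definition act_image : {set V} := [set act f v | v : V].

Lemma submod_act_image : submod_set act_image.
Proof.
split=> [|u v /imsetP[u' _ ->] /imsetP[v' _ ->]|g v /imsetP[v' _ ->]].
- by apply/imsetP; exists 0 => //; rewrite linear0.
- by apply/imsetP; exists (u' + v') => //; rewrite linearD.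
- apply/imsetP; exists (act g v'); first by [].
  by rewrite -!actM mulrC.
Qed.

Lemma card_act_image : (#|act_image| * 2 ^ kerdim q f = 2 ^ (q ^ n))%N.
Proof.
have -> : #|act_image| = #|limg (linfun (act f) : 'End(boxmod n q))|.
  apply: eq_card => v; apply/imsetP/memv_imgP.
    by case=> w _ ->; exists w; rewrite ?memvf // lfunE.
  by case=> w _; rewrite lfunE; exists w.
rewrite card_vspace card_Fp // -expnD addnC /kerdim -[lker _]capfv limg_ker_dim.
rewrite -card_box -[X in (X ^ _)%N](@card_Fp 2) // -card_vspace.
by apply: eq_card => v; rewrite memvf.
Qed.

Lemma act_mon_out a v : ~~ in_box q a -> act (msmon a) v = 0.
Proof.
rewrite negb_forall => /existsP[i]; rewrite -leqNgt => ai.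
apply/ffunP => b; rewrite !ffunE mscoef_monM; case: ifP => // /mnm_lepP/(_ i).
by rewrite mboxE leqNgt (leq_trans (ltn_ord _) ai).
Qed.

(** The nonzero module V/S has a socle: multiply an element outside of S by a monomial of
the largest degree that keeps it outside. *)
Lemma ex_socle S : submod_set S -> S != [set: V] -> exists2 v, v \notin S &
  forall i, act (msvar 'F_2 i) v \in S.
Proof.
move=> sS; rewrite -subTset => /subsetPn[v _ vS].
pose P k := `[< exists2 a : multinom n, mdeg a = k & act (msmon a) v \notin S >].
have exP : exists k, P k.
  by exists 0%N; apply/asboolP; exists mnm0; rewrite ?mdeg0 // msmon0 act1.
have Pb k : P k -> (k <= n * q)%N.
  case/asboolP=> a <-; case: (boolP (in_box q a)) => [/forallP aq _|/act_mon_out ->].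
    rewrite mdegE -[X in (_ <= X * _)%N]card_ord -sum_nat_const.
    by apply: leq_sum => i _; apply: ltnW.
  by case: sS => ->.
have [k /asboolP[a ak aS] kmax] := ex_maxnP exP Pb.
exists (act (msmon a) v) => // i; rewrite -actM msmonE -msmonD.
apply: contrapT => /negP iS; have : P k.+1.
  by apply/asboolP; exists (mnm_add (mnm1 i) a); rewrite // mdegD mdeg1 ak.
by move/kmax; rewrite ltnn.
Qed.

(** Adjoining an element v that all variables send into S adds v + S only, because a
series acts on v through its constant term modulo S. *)
Lemma submod_extend S : submod_set S -> S != [set: V] -> exists S',
  [/\ submod_set S', S \subset S' & #|S'| = (2 * #|S|)%N].
Proof.
move=> sS /(ex_socle sS)[v vS vx]; have [S0 SD SA] := sS.
exists (adjoin S v); split; last first.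
- by apply: card_adjoin => //; exact: boxmod_char2.
- exact: subsetUl.
have gv g : exists2 u, u \in S & act g v = u \/ act g v = v + u.
  pose c := msC n (mscoef g mnm0).
  have [|h gE] := @mscoef0_gen n (g - c).
    by rewrite mscoefB /= eqxx mulr1 subrr.
  exists (act (g - c) v).
    rewrite gE act_sum; elim/big_ind: _ => [//|//|i _].
    by rewrite mulrC actM; apply: SA.
  have -> : act g v = act (g - c) v + act c v by rewrite -actD subrK.
  move: (act (g - c) v) => u; rewrite /c [mscoef g _]F2E.
  case: (_ != 0); rewrite ?rmorph1 ?rmorph0.
    by right; rewrite act1 addrC.
  by left; rewrite act0 addr0.
have inA w : w \in adjoin S v <-> exists2 u, u \in S & w = u \/ w = v + u.
  rewrite inE; split=> [/orP[wS|/imsetP[u uS ->]]|[u uS [->|->]]].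
  - by exists w => //; left.
  - by exists u => //; right.
  - by rewrite uS.
  - by apply/orP; right; apply/imsetP; exists u.
split=> [|u w|g w].
- by apply/inA; exists 0 => //; left.
- move=> /inA[u1 u1S uE] /inA[w1 w1S wE]; apply/inA; exists (u1 + w1); first exact: SD.
  case: uE wE => -> [] ->; [by left|by right; rewrite addrCA| |left].
    by right; rewrite addrA.
  by rewrite addrACA boxmod_char2 add0r.
- move=> /inA[u uS wE]; have [u' u'S gE] := gv g.
  case: wE => ->; first by apply/inA; exists (act g u); [exact: SA|left].
  rewrite linearD /=; apply/inA; exists (u' + act g u).
    by apply: SD => //; apply: SA.
  by case: gE => ->; [left|right; rewrite addrA].
Qed.

Lemma submod_chain : exists S : nat -> {set V},
  [/\ S 0%N = act_image, forall i, submod_set (S i),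
   forall i, S i \subset S i.+1 &
   forall i, (i < kerdim q f)%N -> #|S i.+1| = (2 * #|S i|)%N].
Proof.
have /choice[next nextP] : forall S, exists S', submod_set S -> S != [set: V] ->
    [/\ submod_set S', S \subset S' & #|S'| = (2 * #|S|)%N].
  move=> S; have [[sS SV]|no] := pselect (submod_set S /\ S != [set: V]).
    by have [S' ?] := submod_extend sS SV; exists S'.
  by exists S => sS SV; case: no.
pose nx S := if S == [set: V] then S else next S.
have sub i : submod_set (iter i nx act_image).
  elim: i => [|i IH]; first exact: submod_act_image.
  by rewrite iterS /nx; case: eqVneq => // SV; case: (nextP _ IH SV).
exists (fun i => iter i nx act_image); split=> // [i|i iK].
  by rewrite iterS {2}/nx; case: eqVneq => // SV; case: (nextP _ (sub i) SV).
have cS : #|iter i nx act_image| = (2 ^ i * #|act_image|)%N /\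
    iter i nx act_image != [set: V].
  elim: i iK => [|i IH] iK.
    split; first by rewrite mul1n.
    apply/eqP => /= E; have := card_act_image; rewrite E cardsT card_box.
    have : (1 < 2 ^ kerdim q f)%N by rewrite -[X in (X < _)%N](expn0 2) ltn_exp2l.
    move=> k1 /eqP; rewrite -[X in _ == X]muln1 eqn_pmul2l ?expn_gt0 // => /eqP k1'.
    by rewrite k1' in k1.
  have [cI nI] := IH (ltnW iK); have [_ _ cN] := nextP _ (sub i) nI.
  have cE : #|iter i.+1 nx act_image| = (2 ^ i.+1 * #|act_image|)%N.
    by rewrite iterS {1}/nx (negbTE nI) cN cI expnS mulnA.
  split=> //; apply/eqP => E; move: cE; rewrite E cardsT card_box -card_act_image.
  move/eqP; rewrite mulnC eqn_pmul2r; last first.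
    by apply/card_gt0P; exists 0; case: submod_act_image.
  by rewrite eqn_exp2l // => /eqP kE; rewrite kE ltnn in iK.
have [_ nI] := cS; have [_ _ cN] := nextP _ (sub i) nI.
by rewrite iterS {1}/nx (negbTE nI) cN.
Qed.
End BoxSubmodules.

(** * The Hilbert-Kunz function as a kernel dimension *)

Section HilbertKunz.
Variables (n : nat) (f : mseries n 'F_2) (A : comNzRingType).
Variable pr : {rmorphism mseries n 'F_2 -> A}.
Hypothesis pr_surj : forall a, exists u, pr u = a.
Hypothesis pr_ker : forall u, pr u = 0 <-> exists h, u = h * f.
Hypothesis f0 : mscoef f mnm0 = 0.
Variable e : nat.
Local Notation q := (2 ^ e)%N.
Local Notation V := (boxmod n q).
Local Notation mq := (frob_power (@nonunits A) q).
Local Notation M := (quot_mod mq).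

Lemma nonunit_series u : (pr u \in @nonunits A) = (mscoef u mnm0 == 0).
Proof.
rewrite /nonunits -topredE /=; apply/idP/idP => [|u0].
  apply: contraNT => u0; apply/asboolP; have [|v uv] := @mseries_unit _ u.
    by rewrite [LHS]F2E u0.
  by exists (pr v); rewrite -rmorphM uv rmorph1.
apply/asboolP => -[b]; have [v <-] := pr_surj b.
move/eqP; rewrite -rmorphM -(rmorph1 pr) -subr_eq0 -rmorphB => /eqP /pr_ker[h].
move/(congr1 (fun u => mscoef u mnm0)); rewrite mscoefB !mscoef0M (eqP u0) f0.
by rewrite mul0r mulr0 sub0r /= => /eqP; rewrite oppr_eq0 eqxx oner_eq0.
Qed.

(** The Frobenius power of the maximal ideal of A is the image of (x_1^q, ..., x_n^q),
since q-th powers are additive in characteristic 2. *)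
Lemma frob_powerE u :
  ((pr u : A^o) \in mq) <-> bproj q u \in act_image q f.
Proof.
split=> [|/imsetP[v _ uE]].
  move/asboolP.
  pose I : {pred A^o} := fun a =>
    `[< forall u, pr u = a -> bproj q u \in act_image q f >].
  have prE u1 u2 : pr u1 = pr u2 ->
      bproj q u2 \in act_image q f -> bproj q u1 \in act_image q f.
    move=> u12 i2; have /pr_ker[h hE] : pr (u1 - u2) = 0 by rewrite rmorphB u12 subrr.
    rewrite -[u1](subrK u2) bprojD hE; have [_ D _] := submod_act_image q f.
    apply: D => //; rewrite mulrC bprojM; exact: imset_f.
  have inI v : (pr v : A^o) \in I <-> bproj q v \in act_image q f.
    split=> [/asboolP/(_ v erefl)//|vI]; apply/asboolP => w wv; exact: prE vI.
  have [im0 imD imA] := submod_act_image q f.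
  have Isub : GRing.subsemimod_closed I.
    split; first split.
    - rewrite -(rmorph0 pr); apply/inI.
      by rewrite bproj0.
    - move=> a b; have [[u1 <-] [u2 <-]] := (pr_surj a, pr_surj b).
      move=> /inI i1 /inI i2; rewrite -rmorphD; apply/inI; rewrite bprojD; exact: imD.
    - move=> a b; have [[u1 <-] [u2 <-]] := (pr_surj a, pr_surj b).
      move=> /inI i2; rewrite -[_ *: _]/(pr u1 * pr u2) -rmorphM; apply/inI.
      by rewrite bprojM; apply: imA.
  pose B := GRing.isSubmodClosed.Build A A^o I Isub.
  pose I' : submodClosed A^o := HB.pack I B.
  move=> /(_ I') uI; apply/inI; apply: uI => _ /asboolP[a am ->].
  have [w wa] := pr_surj a; rewrite -wa -rmorphXn; apply/inI.
  move: am; rewrite -wa nonunit_series => /eqP /mscoef0_gen[c ->].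
  rewrite exprX2_sum; last exact: mseries_char2.
  have -> : forall r : seq 'I_n,
      bproj q (\sum_(i <- r) (msvar 'F_2 i * c i) ^+ q) = 0 => //.
  elim=> [|i r IH]; first by apply/ffunP => b; rewrite big_nil !ffunE.
  rewrite big_cons bprojD IH addr0 exprMn bprojM.
  by rewrite act_varX.
have /bproj0_gen[c cE] : bproj q (u - f * bsec v) = 0.
  apply/ffunP => b; rewrite !ffunE mscoefB.
  by move/ffunP: uE => /(_ b); rewrite !ffunE => ->; rewrite subrr.
have -> : pr u = pr (u - f * bsec v).
  rewrite rmorphB (_ : pr (f * bsec v) = 0) ?subr0 //.
  by apply/pr_ker; exists (bsec v); rewrite mulrC.
rewrite cE; apply/asboolP => I mI.
have -> : forall r : seq 'I_n,
    (pr (\sum_(i <- r) msvar 'F_2 i ^+ q * c i) : A^o) \in I => //.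
elim=> [|i r IH]; first by rewrite big_nil rmorph0 rpred0.
rewrite big_cons rmorphD; apply: rpredD => //.
rewrite mulrC rmorphM rmorphXn; apply: rpredZ; apply: mI; apply/asboolP.
by exists (pr (msvar 'F_2 i)) => //; rewrite nonunit_series mscoef0_var.
Qed.

Definition frob_class (u : mseries n 'F_2) : M := (\pi_M (pr u : A^o))%qT.

Lemma frob_classD u v : frob_class (u + v) = frob_class u + frob_class v.
Proof. by rewrite /frob_class rmorphD (raddfD \pi_M%qT). Qed.

Lemma frob_classZ u v : frob_class (u * v) = pr u *: frob_class v.
Proof. by rewrite /frob_class rmorphM; exact/esym/quot_scaleE. Qed.

Lemma frob_class_surj x : exists u, frob_class u = x.
Proof.
rewrite /frob_class -[x]reprK; have [u uE] := pr_surj (repr x); exists u.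
by rewrite uE.
Qed.

Lemma frob_class_eq u v :
  bproj q u + bproj q v \in act_image q f <-> frob_class u = frob_class v.
Proof.
rewrite -bprojD -[u + v]/(u + v) -[X in u + X]mseries_oppr -frob_powerE rmorphB.
rewrite -quot_modP; split=> [/eqP|/eqP] //.
Qed.

(** A submodule of A/m^[q] is a submodule of the box module that contains f V. A chain of
k + 1 of them multiplies the size by at least 2^k, and submod_chain attains the bound. *)
Lemma HK_kerdim : HK 2 e A = kerdim q f.
Proof.
have [im0 imD imA] := submod_act_image q f.
apply: nat_max_eq => [|k [N Ns]].
  have [S [S0 Ssub SS Scard]] := submod_chain q f.
  have imS i : act_image q f \subset S i.
    elim: i => [|i IH]; first by rewrite S0.
    exact: subset_trans IH (SS i).
  pose I i : {pred M} := fun x =>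
    `[< exists2 u, frob_class u = x & bproj q u \in S i >].
  have inI i u : (frob_class u \in I i) <-> bproj q u \in S i.
    split=> [/asboolP[v /esym/frob_class_eq uv vS]|uS]; last by apply/asboolP; exists u.
    have [_ D _] := Ssub i.
    have := D _ _ (fintype.subsetP (imS i) _ uv) vS.
    by rewrite -addrA boxmod_char2 addr0.
  have Isub i : GRing.subsemimod_closed (I i).
    have [s0 sD sA] := Ssub i; split; first split.
    - rewrite (_ : 0 = frob_class 0); first by apply/inI; rewrite bproj0.
      by rewrite /frob_class rmorph0 (raddf0 \pi_M%qT).
    - move=> a b; have [[u <-] [v <-]] := (frob_class_surj a, frob_class_surj b).
      move=> /inI uS /inI vS; rewrite -frob_classD; apply/inI; rewrite bprojD.
      exact: sD.
    - move=> a b; have [[u <-] [v <-]] := (pr_surj a, frob_class_surj b).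
      move=> /inI vS; rewrite -frob_classZ; apply/inI; rewrite bprojM; exact: sA.
  pose B i := GRing.isSubmodClosed.Build A M (I i) (Isub i).
  exists (fun i => HB.pack (I i) (B i) : submodClosed M) => i iK; split=> [x|sub].
    have [u <-] := frob_class_surj x; move=> /inI uS; apply/inI.
    exact: (fintype.subsetP (SS i)).
  have : S i.+1 \subset S i.
    apply/fintype.subsetP => v vS; have := sub (frob_class (bsec v)); rewrite !inI.
    by move=> /(_ _)/wrap[|//]; rewrite ?inI bsecK.
  move=> /subset_leq_card; rewrite Scard // mul2n -addnn.
  rewrite -[X in (_ <= X)%N]addn0 leq_add2l leqn0.
  rewrite cards_eq0 => /eqP Si0; have [s0 _ _] := Ssub i.
  by rewrite Si0 inE in s0.
pose S i : {set V} := [set v | frob_class (bsec v) \in N i].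
have inS i u : (frob_class u \in N i) = (bproj q u \in S i).
  rewrite in_set; suff -> : frob_class u = frob_class (bsec (bproj q u)) by [].
  by apply/frob_class_eq; rewrite bsecK boxmod_char2.
have Sadd i : add_set (S i).
  split=> [|u v].
    by rewrite -(bproj0 n q) -inS /frob_class rmorph0 (raddf0 \pi_M%qT) rpred0.
  rewrite -[u]bsecK -[v]bsecK -bprojD -!inS frob_classD; exact: rpredD.
have imS : act_image q f \subset S 0%N.
  apply/fintype.subsetP => v vi; rewrite inE (_ : frob_class _ = frob_class 0).
    by rewrite /frob_class rmorph0 (raddf0 \pi_M%qT) rpred0.
  by apply/frob_class_eq; rewrite bsecK bproj0 addr0.
have Sk i : (i <= k)%N -> (2 ^ i * #|act_image q f| <= #|S i|)%N.
  elim: i => [_|i IH ik]; first by rewrite mul1n; exact: subset_leq_card.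
  have [sub nsub] := Ns i ik.
  have SS : S i \subset S i.+1.
    by apply/fintype.subsetP => v; rewrite !in_set => vN; exact: sub vN.
  have [x xN xN'] : exists2 x, x \in N i.+1 & x \notin N i.
    apply: contrapT => no; apply: nsub => x xN; apply: contrapT => /negP xN'.
    by apply: no; exists x.
  have [u uE] := frob_class_surj x; rewrite -uE inS in xN; rewrite -uE inS in xN'.
  have := card_add_set_lt (@boxmod_char2 n q) (Sadd i) (Sadd i.+1) SS xN xN'.
  by apply: leq_trans; rewrite expnS -mulnA leq_mul2l IH // ltnW.
have := leq_trans (Sk k (leqnn k)) (max_card _).
rewrite card_box -(card_act_image q f) mulnC leq_pmul2l ?leq_exp2l //.
by apply/card_gt0P; exists 0.
Qed.
End HilbertKunz.

(** * Splitting off the last variable *)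

Lemma card_slices (U V W : finType) (c : U -> W -> V) (P : pred U) (Q : pred V) :
  (forall u u', c u =1 c u' -> u = u') ->
  (forall F : {ffun W -> V}, exists u, c u =1 F) ->
  (forall u, P u = [forall w, Q (c u w)]) ->
  #|[set u | P u]| = (#|[set v | Q v]| ^ #|W|)%N.
Proof.
move=> cinj csurj PQ; rewrite -card_ffun_on.
pose h u := [ffun w => c u w].
have hinj : injective h.
  by move=> u u' /ffunP uu'; apply: cinj => w; have := uu' w; rewrite !ffunE.
rewrite -(card_imset _ hinj); apply: eq_card => F; apply/imsetP/ffun_onP.
  by case=> u; rewrite inE PQ => /forallP uQ -> w; rewrite ffunE inE.
have [u uF] := csurj F => FQ; exists u; last by apply/ffunP => w; rewrite ffunE uF.
by rewrite inE PQ; apply/forallP => w; rewrite uF; have := FQ w; rewrite inE.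
Qed.

Lemma leq_card_slices (U V T : finType) (c : U -> T -> V) (P : pred U)
    (Q : T -> pred V) :
  (forall u u', P u -> P u' -> c u =1 c u' -> u = u') ->
  (forall u t, P u -> Q t (c u t)) ->
  (#|[set u | P u]| <= \prod_t #|[set v | Q t v]|)%N.
Proof.
move=> cinj PQ; pose h u := [ffun t => c u t].
pose F t := [set v | Q t v].
have -> : (\prod_t #|F t| = #|(family (fun t => mem (F t)))|)%N.
  by rewrite card_family foldrE big_map big_enum.
rewrite -(card_in_imset (f := h)); last first.
  move=> u u'; rewrite !inE => Pu Pu' /ffunP uu'; apply: cinj => // t.
  by have := uu' t; rewrite !ffunE.
apply: subset_leq_card; apply/subsetP => _ /imsetP[u + ->]; rewrite inE => Pu.
by apply/familyP => t; rewrite ffunE inE; apply: PQ.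
Qed.

Lemma eq_kerdim n q (f g : mseries n 'F_2) :
  (forall v : boxmod n q, act f v = act g v) ->
  kerdim q f = kerdim q g.
Proof.
by move=> fg; apply/eqP; rewrite eqn_leq; apply/andP; split;
  apply: kerdim_mono => v; rewrite fg.
Qed.

Definition nvar n i : mseries n 'F_2 := if insub i is Some j then msvar 'F_2 j else 0.

Lemma nvarE n i (i_n : (i < n)%N) : nvar n i = msvar 'F_2 (Ordinal i_n).
Proof. by rewrite /nvar insubT. Qed.

Lemma xvarE d i : (i <= d)%N -> xvar d i = nvar d.+1 i.
Proof.
rewrite -ltnS => id; rewrite nvarE /xvar; congr (msvar _ _); apply/val_inj.
by rewrite /= inordK.
Qed.

Lemma boxmod_addr0_eq n q (v w : boxmod n q) : v + w = 0 -> v = w.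
Proof. by move=> vw; rewrite -[v]addr0 -(boxmod_char2 w) addrA vw add0r. Qed.

Section Slices.
Variable n : nat.
Implicit Types (f g : mseries n 'F_2) (F G u : mseries n.+1 'F_2).

Definition slice k u : mseries n 'F_2 := MSeries (fun a => mscoef u (mext a k)).

(** F is the series f seen in one more variable. Stated through slices, the relation is
closed under sums and products, and reduces to the case of a variable. *)
Definition lifts f F := forall k u, slice k (F * u) = f * slice k u.

Lemma sliceD k u (v : mseries n.+1 'F_2) : slice k (u + v) = slice k u + slice k v.
Proof. exact: mseriesP. Qed.

Lemma liftsD f g F G : lifts f F -> lifts g G -> lifts (f + g) (F + G).
Proof. by move=> fF gG k u; rewrite mulrDl sliceD fF gG mulrDl. Qed.

Lemma liftsM f g F G : lifts f F -> lifts g G -> lifts (f * g) (F * G).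
Proof. by move=> fF gG k u; rewrite -!mulrA fF gG. Qed.

Lemma lifts0 : lifts 0 0.
Proof. by move=> k u; rewrite !mul0r; apply: mseriesP. Qed.

Lemma lifts1 : lifts 1 1.
Proof. by move=> k u; rewrite !mul1r. Qed.

Lemma liftsX f F k : lifts f F -> lifts (f ^+ k) (F ^+ k).
Proof.
by move=> fF; elim: k => [|k IH]; [exact: lifts1|rewrite !exprS; exact: liftsM].
Qed.

Lemma lifts_var i : (i < n)%N -> lifts (nvar n i) (nvar n.+1 i).
Proof.
move=> i_n k u; rewrite (nvarE i_n) (nvarE (ltnW i_n : i < n.+1)%N).
set j := Ordinal i_n.
have -> : Ordinal (ltnW i_n : i < n.+1)%N = widen_ord (leqnSn n) j by exact/val_inj.
apply: mseriesP => a; rewrite mscoef_varM.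
rewrite -[LHS]/(mscoef (msvar 'F_2 (widen_ord (leqnSn n) j) * u) (mext a k)).
rewrite mscoef_varM mext_widen -[mscoef (slice _ _) _]/(mscoef u (mext _ k)).
case: ltnP => // aj; congr (mscoef u _).
have aE : a = mnm_add (mnm_sub a (mnm1 j)) (mnm1 j).
  by rewrite submK //; apply/mnm_lepP => l; rewrite mnm1E; case: eqP => // <-.
by rewrite {1}aE -[in LHS](addn0 k) mextD mext1_wid addmK.
Qed.

Lemma slice_last j k u :
  slice k (nvar n.+1 n ^+ j * u) = if (j <= k)%N then slice (k - j) u else 0.
Proof.
rewrite (nvarE (ltnSn n)); have -> : Ordinal (ltnSn n) = ord_max by exact/val_inj.
apply: mseriesP => a.
rewrite -[LHS]/(mscoef (msvar 'F_2 ord_max ^+ j * u) (mext a k)).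
rewrite mscoef_varXM mext_max.
case: leqP => // jk; rewrite -[RHS]/(mscoef u (mext a (k - j))); congr (mscoef u _).
by rewrite -{1}(subnK jk) -{1}(addm0 a) mextD mext0n addmK.
Qed.

Variable q : nat.
Implicit Types (v w : boxmod n.+1 q).

Definition bslice k v : boxmod n q := bproj q (slice k (bsec v)).

Lemma in_box_ext (a : multinom n) k : in_box q (mext a k) = in_box q a && (k < q)%N.
Proof.
apply/forallP/andP => [ak|[/forallP aq kq] i].
  split; last by have := ak ord_max; rewrite mext_max.
  by apply/forallP => i; have := ak (widen_ord (leqnSn n) i); rewrite mext_widen.
by case: (ordSP i) => [j|]; rewrite ?mext_widen ?mext_max.
Qed.

Lemma bslice_proj k u : (k < q)%N -> bslice k (bproj q u) = bproj q (slice k u).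
Proof.
move=> kq; apply/bprojP => a aq /=.
by rewrite -[LHS]/(mscoef (bsec _) _) bprojK // in_box_ext aq.
Qed.

Lemma bslice_inj v w : (forall k, (k < q)%N -> bslice k v = bslice k w) -> v = w.
Proof.
move=> vw; rewrite -[v]bsecK -[w]bsecK; apply/bprojP => m.
rewrite -(mext_restr m) in_box_ext => /andP[mq kq].
by have /bprojP/(_ _ mq) := vw _ kq.
Qed.

Lemma bslice_surj (F : nat -> boxmod n q) :
  exists v, forall k, (k < q)%N -> bslice k v = F k.
Proof.
exists (bproj q (MSeries (fun m => mscoef (bsec (F (m ord_max))) (mrestr m)))) => k kq.
rewrite bslice_proj // -[RHS]bsecK; congr (bproj _ _); apply: mseriesP => a /=.
by rewrite mext_max mrestr_ext.
Qed.

Lemma bslice_act k f F v : (k < q)%N -> lifts f F ->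
  bslice k (act F v) = act f (bslice k v).
Proof. by move=> kq fF; rewrite bslice_proj // fF bprojM. Qed.

Lemma bslice_actX j k v : (k < q)%N ->
  bslice k (act (nvar n.+1 n ^+ j) v) = if (j <= k)%N then bslice (k - j) v else 0.
Proof.
by move=> kq; rewrite bslice_proj // slice_last; case: ifP => // _; rewrite bproj0.
Qed.

Lemma bsliceD k v w : (k < q)%N -> bslice k (v + w) = bslice k v + bslice k w.
Proof.
by move=> kq; rewrite -[v]bsecK -[w]bsecK -bprojD !bslice_proj // sliceD bprojD.
Qed.

Lemma bslice0 k : (k < q)%N -> bslice k 0 = 0.
Proof. by move=> kq; rewrite -(bproj0 n.+1 q) bslice_proj // -[RHS](bproj0 n q). Qed.

Lemma kerdim_lift f F : lifts f F -> kerdim q F = (q * kerdim q f)%N.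
Proof.
move=> fF; apply/eqP; rewrite -(eqn_exp2l _ _ (ltnSn 1)) mulnC expnM -!card_ker.
apply/eqP.
rewrite -[X in (_ ^ X)%N](card_ord q).
apply: (card_slices (c := fun v (k : 'I_q) => bslice k v)) => [v w vw|H|v].
- by apply: bslice_inj => k kq; apply: (vw (Ordinal kq)).
- have [v vF] := bslice_surj (fun k => if insub k is Some i then H i else 0).
  by exists v => k; rewrite vF // valK.
- apply/eqP/forallP => [v0 k|vk].
    by rewrite -(bslice_act _ (ltn_ord k) fF) v0 bslice0.
  apply: bslice_inj => k kq; rewrite (bslice_act _ kq fF) bslice0 //.
  exact/eqP/(vk (Ordinal kq)).
Qed.

(** In terms of the coefficients v_k of the powers z^k, the kernel is given by
f v_k = v_(k-a), or 0 if k < a. So v is determined by its last a coefficients, and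
v_k is killed by the power of f that leads below the index 0. *)
Lemma kerdim_add_pow f F a : (0 < a <= q)%N -> lifts f F ->
  (kerdim q (F + nvar n.+1 n ^+ a)%R
    <= \sum_(t < a) kerdim q (f ^+ ((q - a + t) %/ a).+1)%R)%N.
Proof.
move=> /andP[a0 aq] fF; rewrite -(leq_exp2l _ _ (ltnSn 1)) expn_sum.
under eq_bigr do rewrite -card_ker; rewrite -card_ker.
set G := F + _.
have step v k : act G v = 0 -> (k < q)%N ->
    act f (bslice k v) = if (a <= k)%N then bslice (k - a) v else 0.
  move=> gv kq; apply: boxmod_addr0_eq; rewrite -(bslice_actX _ _ kq).
  by rewrite -(bslice_act _ kq fF) -bsliceD // -actD gv bslice0.
have steps v j k : act G v = 0 -> (k + j * a < q)%N ->
    act (f ^+ j) (bslice (k + j * a) v) = bslice k v.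
  move=> Gv; elim: j => [|j IH] kq; first by rewrite addn0 act1.
  have E : (k + j.+1 * a - a = k + j * a)%N by rewrite mulSn addnCA addKn.
  rewrite exprSr actM step // E (_ : (a <= _)%N); last first.
    by rewrite mulSn addnCA leq_addr.
  by apply: IH; apply: leq_ltn_trans kq; rewrite leq_add2l leq_mul2r leqnSn orbT.
have kill v k : act G v = 0 -> (k < q)%N -> act (f ^+ (k %/ a).+1) (bslice k v) = 0.
  move=> Gv kq; have kE : k = (k %% a + k %/ a * a)%N by rewrite addnC -divn_eq.
  rewrite exprS actM {2}kE steps -?kE // step //; last first.
    exact: leq_ltn_trans (leq_mod _ _) kq.
  by rewrite leqNgt ltn_mod a0.
apply: (leq_card_slices (c := fun v (t : 'I_a) => bslice (q - a + t) v)) => [v w|v t].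
  move=> /eqP Gv /eqP Gw vw; apply: bslice_inj => k kq.
  (* The index k reaches the last a indices in j steps of length a. *)
  pose j := ((q.-1 - k) %/ a)%N; pose t := ((q.-1 - k) %% a)%N.
  have ta : (a.-1 - t < a)%N by rewrite ltn_subLR; lia.
  have kj : (k + j * a = q - a + Ordinal ta)%N.
    have := divn_eq (q.-1 - k) a; have : (t < a)%N by rewrite ltn_mod.
    rewrite -/j -/t /=; lia.
  have jq : (k + j * a < q)%N by rewrite kj /=; lia.
  by rewrite -(steps v j) // -(steps w j) // kj vw.
by move=> /eqP Gv; apply/eqP; apply: kill => //; have := ltn_ord t; lia.
Qed.
End Slices.

Section AddProduct.
Variables (n q : nat) (f : mseries n 'F_2) (F1 : mseries n.+1 'F_2).
Variable F : mseries n.+2 'F_2.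
Hypotheses (fF1 : lifts f F1) (F1F : lifts F1 F).
Local Notation xy := (nvar n.+2 n * nvar n.+2 n.+1).

Definition bslice2 i j (v : boxmod n.+2 q) : boxmod n q := bslice i (bslice j v).

Lemma bslice2_step v i j : act (F + xy) v = 0 -> (i < q)%N -> (j < q)%N ->
  act f (bslice2 i j v) = if (0 < i)%N && (0 < j)%N then bslice2 i.-1 j.-1 v else 0.
Proof.
move=> Fv iq jq; apply: boxmod_addr0_eq.
have -> : (if (0 < i)%N && (0 < j)%N then bslice2 i.-1 j.-1 v else 0) =
    bslice2 i j (act xy v).
  rewrite /bslice2 mulrC actM -[nvar n.+2 n.+1]expr1 bslice_actX //.
  case: (ltnP 0 j) => j0; last by rewrite andbF bslice0.
  have j1q : (j - 1 < q)%N by rewrite (leq_ltn_trans _ jq) ?leq_subr.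
  rewrite (bslice_act _ j1q (lifts_var (ltnSn n))) -[nvar n.+1 n]expr1 bslice_actX //.
  by rewrite andbT !subn1.
rewrite /bslice2 -(bslice_act _ iq fF1) -(bslice_act _ jq F1F) -!bsliceD // -actD Fv.
by rewrite !bslice0.
Qed.

Lemma bslice2_steps v k i j : act (F + xy) v = 0 -> (i + k < q)%N -> (j + k < q)%N ->
  act (f ^+ k) (bslice2 (i + k) (j + k) v) = bslice2 i j v.
Proof.
move=> Fv; elim: k => [|k IH] iq jq; first by rewrite !addn0 act1.
rewrite exprSr actM bslice2_step // !addnS /=; apply: IH; lia.
Qed.

Lemma bslice2_kill v i j : act (F + xy) v = 0 -> (i < q)%N -> (j < q)%N ->
  act (f ^+ (minn i j).+1) (bslice2 i j v) = 0.
Proof.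
move=> Fv iq jq; set k := minn i j.
have iE : (i - k + k = i)%N by rewrite subnK // geq_minl.
have jE : (j - k + k = j)%N by rewrite subnK // geq_minr.
have := @bslice2_steps v k (i - k) (j - k) Fv; rewrite iE jE exprS actM => -> //.
rewrite bslice2_step //; [|lia|lia].
by rewrite (_ : _ && _ = false) //; apply/negP => /andP[]; rewrite /k; lia.
Qed.

(** With v_ij the coefficient of x^i y^j, the kernel equations f v_ij = v_(i-1)(j-1) run
along the diagonals. So the kernel is determined by the v_ij with i or j equal to
q - 1, one at the end of each diagonal. The sum type indexes them: inr j is the pair
(q - 1, j), and inl j is (j - 1, q - 1), where inl 0 is a dummy that carries f^0 = 1. *)
Lemma kerdim_add_mul : (kerdim q (F + xy)%R <=
  \sum_(j < q) (kerdim q (f ^+ j)%R + kerdim q (f ^+ j.+1)%R))%N.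
Proof.
pose N (t : 'I_q + 'I_q) := match t with inl j => j : nat | inr j => j.+1 end.
have -> : (\sum_(j < q) (kerdim q (f ^+ j)%R + kerdim q (f ^+ j.+1)%R) =
    \sum_(t : 'I_q + 'I_q) kerdim q (f ^+ N t)%R)%N.
  by rewrite big_split big_sumType.
rewrite -(leq_exp2l _ _ (ltnSn 1)) expn_sum.
under eq_bigr do rewrite -card_ker; rewrite -card_ker.
pose c (v : boxmod n.+2 q) (t : 'I_q + 'I_q) := match t with
  | inl j => if nat_of_ord j is k.+1 then bslice2 k q.-1 v else 0
  | inr j => bslice2 q.-1 j v end.
apply: (leq_card_slices (c := c)) => [v w /eqP Fv /eqP Fw vw|v t /eqP Fv].
  have E i j : (i < q)%N -> (j < q)%N -> bslice2 i j v = bslice2 i j w.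
    move=> iq jq; have [ij|ji] := leqP j i.
      have k1 : (j + (q.-1 - i) < q)%N by lia.
      rewrite -(@bslice2_steps v (q.-1 - i)) //; last lia.
      rewrite -(@bslice2_steps w (q.-1 - i)) //; last lia.
      rewrite subnKC; last lia.
      by have /= -> := vw (inr (Ordinal k1)).
    have k1 : ((i + (q.-1 - j)).+1 < q)%N by lia.
    rewrite -(@bslice2_steps v (q.-1 - j)) //; [|lia|lia].
    rewrite -(@bslice2_steps w (q.-1 - j)) //; [|lia|lia].
    rewrite [(j + _)%N]subnKC; last lia.
    by have /= -> := vw (inl (Ordinal k1)).
  apply: bslice_inj => j jq; apply: bslice_inj => i iq; exact: E.
apply/eqP; case: t => j /=; have jq := ltn_ord j; last first.
  rewrite (_ : j.+1 = (minn q.-1 j).+1) ?bslice2_kill //; lia.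
case: (nat_of_ord j) jq => [|k] kq; first by rewrite linear0.
rewrite (_ : k.+1 = (minn k q.-1).+1) ?bslice2_kill //; lia.
Qed.
End AddProduct.

(** * Frobenius self-similarity *)

Section Doubling.
Variable n : nat.
Implicit Types (f g u : mseries n 'F_2) (a m : multinom n) (r : {ffun 'I_n -> bool}).

Definition mdbl a r : multinom n := Multinom (mktuple (fun i => (a i).*2 + r i)%N).

Lemma mdblE a r i : mdbl a r i = ((a i).*2 + r i)%N. Proof. by rewrite mnmE. Qed.

Definition parity r u : mseries n 'F_2 := MSeries (fun a => mscoef u (mdbl a r)).

Lemma parityD r u v : parity r (u + v) = parity r u + parity r v.
Proof. exact: mseriesP. Qed.

(** This says that f^2 = f(x^2), that is that f^2 acts as f on each parity class. All series
over F_2 have the property; for polynomials it follows from that of the variables. *)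
Definition halves f := forall r u, parity r (f ^+ 2 * u) = f * parity r u.

Lemma halvesM f g : halves f -> halves g -> halves (f * g).
Proof. by move=> hf hg r u; rewrite exprMn -[f ^+ 2 * _ * u]mulrA hf hg mulrA. Qed.

Lemma halvesD f g : halves f -> halves g -> halves (f + g).
Proof.
move=> hf hg r u; rewrite sqrrD mulr2n mseries_char2 addr0 !mulrDl.
by rewrite parityD hf hg.
Qed.

Lemma halves0 : halves 0.
Proof. by move=> r u; rewrite expr0n !mul0r; apply: mseriesP. Qed.

Lemma halves1 : halves 1.
Proof. by move=> r u; rewrite expr1n !mul1r. Qed.

Lemma halvesX f k : halves f -> halves (f ^+ k).
Proof.
by move=> hf; elim: k => [|k IH]; [exact: halves1|rewrite exprS; exact: halvesM].
Qed.

Lemma halves_sum (I : Type) (s : seq I) (F : I -> mseries n 'F_2) :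
  (forall i, halves (F i)) -> halves (\sum_(i <- s) F i).
Proof. by move=> hF; elim/big_ind: _ => // *; [exact: halves0|exact: halvesD]. Qed.

Lemma halves_msvar i : halves (msvar 'F_2 i).
Proof.
move=> r u; apply: mseriesP => a; rewrite mscoef_varM.
rewrite -[LHS]/(mscoef (msvar 'F_2 i ^+ 2 * u) (mdbl a r)) mscoef_varXM mdblE.
have -> : (2 <= (a i).*2 + r i)%N = (0 < a i)%N by case: (r i); lia.
case: ltnP => // ai; rewrite -[RHS]/(mscoef u (mdbl (mnm_sub a (mnm1 i)) r)).
congr (mscoef u _); apply/mnmP => j; rewrite mnmBE !mdblE mnmBE mulmnE mnm1E.
by case: eqP => [<-|]; case: (r _); lia.
Qed.

Lemma halves_nvar i : halves (nvar n i).
Proof.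
by rewrite /nvar; case: insubP => [j _ _|_]; [exact: halves_msvar|exact: halves0].
Qed.

Variable q : nat.

Definition bparity r (v : boxmod n (2 * q)) : boxmod n q := bproj q (parity r (bsec v)).

Lemma in_box_dbl a r : in_box (2 * q) (mdbl a r) = in_box q a.
Proof.
apply: eq_forallb => i; rewrite mdblE mul2n; case: (r i); rewrite ?addn0 ?addn1; lia.
Qed.

Lemma bparity_proj r u : bparity r (bproj (2 * q) u) = bproj q (parity r u).
Proof.
apply/bprojP => a aq.
rewrite -[LHS]/(mscoef (bsec (bproj (2 * q) u)) (mdbl a r)) bprojK //.
by rewrite in_box_dbl.
Qed.

Definition mhalf m : multinom n := Multinom (mktuple (fun i => (m i)./2)).

Lemma mdbl_half m : mdbl (mhalf m) [ffun i => odd (m i)] = m.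
Proof.
by apply/mnmP => i; rewrite mdblE mnmE ffunE addnC odd_double_half.
Qed.

Lemma kerdim_double f : halves f -> kerdim (2 * q) (f ^+ 2) = (2 ^ n * kerdim q f)%N.
Proof.
move=> hf; apply/eqP; rewrite -(eqn_exp2l _ _ (ltnSn 1)) [(2 ^ n * _)%N]mulnC.
rewrite expnM -!card_ker; apply/eqP.
have -> : (2 ^ n = #|{: {ffun 'I_n -> bool}}|)%N.
  by rewrite card_ffun card_bool card_ord.
have binj (v w : boxmod n (2 * q)) : (forall r, bparity r v = bparity r w) -> v = w.
  move=> vw; rewrite -[v]bsecK -[w]bsecK; apply/bprojP => m.
  rewrite -(mdbl_half m) in_box_dbl => mq.
  by have /bprojP/(_ _ mq) := vw [ffun i => odd (m i)].
apply: (card_slices (c := fun v r => bparity r v)) => [v w|H|v].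
- exact: binj.
- exists (bproj (2 * q) (MSeries (fun m =>
    mscoef (bsec (H [ffun i => odd (m i)])) (mhalf m)))).
  move=> r; rewrite bparity_proj -[RHS]bsecK; congr (bproj _ _); apply: mseriesP => a.
  have E1 : [ffun i => odd (mdbl a r i)] = r.
    by apply/ffunP => i; rewrite ffunE mdblE oddD odd_double; case: (r i).
  have E2 : mhalf (mdbl a r) = a.
    by apply/mnmP => i; rewrite mnmE mdblE; case: (r i); lia.
  rewrite -[LHS]/(mscoef (bsec (H [ffun i => odd (mdbl a r i)])) (mhalf (mdbl a r))).
  by rewrite E1 E2.
- have E r : act f (bparity r v) = bparity r (act (f ^+ 2) v).
    by rewrite bparity_proj hf bprojM.
  have b0 r : bparity r 0 = 0.
    by rewrite -(bproj0 n (2 * q)) bparity_proj -[RHS](bproj0 n q).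
  apply/eqP/forallP => [v0 r|v0]; first by rewrite E v0 b0.
  by apply: binj => r; rewrite -E b0; apply/eqP/v0.
Qed.

End Doubling.

Lemma kerdim_frob n q k (f : mseries n 'F_2) : halves f ->
  kerdim (2 ^ k * q) (f ^+ (2 ^ k)) = ((2 ^ k) ^ n * kerdim q f)%N.
Proof.
move=> hf; elim: k => [|k IH]; first by rewrite mul1n exp1n mul1n.
have -> : (2 ^ k.+1 * q = 2 * (2 ^ k * q))%N by rewrite expnS mulnA.
rewrite expnSr (exprM f) kerdim_double; last exact: halvesX.
by rewrite IH expnMn mulnA [(2 ^ n * _)%N]mulnC.
Qed.

(** By concavity K(f^2) <= 2 K(f), while K(f^2) is known from the level q. *)
Lemma kerdim_grows n q (f : mseries n 'F_2) : halves f ->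
  (2 ^ n * kerdim q f <= 2 * kerdim (2 * q) f)%N.
Proof.
move=> hf; rewrite -kerdim_double // [(2 * kerdim _ _)%N]mul2n.
have := @kerdim_concave n (2 * q) f 0; rewrite expr1.
by apply: leq_trans; exact: leq_addr.
Qed.

(** * Sums of products of pairs of variables *)

Definition quad n m : mseries n 'F_2 := \sum_(i < m) nvar n i.*2 * nvar n i.*2.+1.

Lemma quadS n m : quad n m.+1 = quad n m + nvar n m.*2 * nvar n m.*2.+1.
Proof. by rewrite /quad big_ord_recr. Qed.

Lemma lifts_quad n m : (m.*2 <= n)%N -> lifts (quad n m) (quad n.+1 m).
Proof.
elim: m => [|m IH] mn; first by rewrite /quad !big_ord0; exact: lifts0.
rewrite !quadS; apply: liftsD; first by apply: IH; lia.
by apply: liftsM; apply: lifts_var; lia.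
Qed.

Lemma halves_quad n m : halves (quad n m).
Proof. by apply: halves_sum => i; apply: halvesM; apply: halves_nvar. Qed.

Section Corner.
Variables (n m q : nat).
Hypothesis mn : (m.*2 <= n)%N.

(** The exponent of x_0^q x_2^q ... x_(2m-2)^q times the remaining variables. The
corresponding monomial is killed by each x_(2i) and not divisible by any x_(2i+1), so
it is in the kernel of the quadric and not in its image. *)
Definition corner : box n q.+1 := [ffun i : 'I_n =>
  if (i < m.*2)%N then if odd i then ord0 else ord_max else inord 1].

Definition corner_ind : boxmod n q.+1 := [ffun b => (b == corner)%:R].

Lemma act_var_corner_ind (i : 'I_n) k : (q < corner i + k)%N ->
  act (msvar 'F_2 i ^+ k) corner_ind = 0.
Proof.
move=> qk; apply/ffunP => b; rewrite !ffunE mscoef_varXM mboxE; case: leqP => // kb.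
have [/in_boxP[c cE]|/bsec_out -> //] :=
  boolP (in_box q.+1 (mnm_sub (mbox b) (mnm_muln (mnm1 i) k))).
rewrite cE bsecE ffunE; case: eqP => // cc.
have := congr1 (fun a : multinom n => a i) cE.
rewrite mnmBE mulmnE mnm1E eqxx mul1n !mboxE cc => bc.
move: kb qk (ltn_ord (b i)); rewrite -bc => kb1; rewrite subnK // => qb.
by rewrite ltnS leqNgt qb.
Qed.

Lemma act_var_corner0 (i : 'I_n) k g (v : boxmod n q.+1) : (corner i < k)%N ->
  act (msvar 'F_2 i ^+ k * g) v corner = 0.
Proof.
move=> ck; rewrite actM ffunE mscoef_varXM mboxE; by rewrite leqNgt ck.
Qed.

Lemma kerdim_sq_lt_corner g : act g corner_ind = 0 ->
  (forall v : boxmod n q.+1, act g v corner = 0) ->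
  (kerdim q.+1 ((quad n m + g) ^+ 2) < (kerdim q.+1 (quad n m + g)).*2)%N.
Proof.
move=> gc gv; apply: (@kerdim_sq_lt _ _ _ corner_ind) => [|v].
  rewrite actD gc addr0 act_sum big1 // => i _.
  have i2n : (i.*2 < n)%N by have := ltn_ord i; lia.
  rewrite mulrC actM (nvarE i2n) -[msvar _ _]expr1 act_var_corner_ind ?linear0 //.
  have im := ltn_ord i.
  rewrite ffunE /= odd_double (_ : (i.*2 < m.*2)%N) /= ?addn1 //; lia.
move/ffunP/(_ corner); rewrite actD act_sum ffunE gv addr0 sum_ffunE big1 => [|i _].
  by rewrite ffunE eqxx => /eqP; rewrite eq_sym oner_eq0.
have i2n : (i.*2.+1 < n)%N by have := ltn_ord i; lia.
rewrite mulrC (nvarE i2n) -[msvar _ _]expr1 act_var_corner0 //.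
have im := ltn_ord i.
rewrite ffunE /= odd_double (_ : (i.*2.+1 < m.*2)%N) //=; lia.
Qed.
End Corner.

Lemma concave_slopes (a : nat -> nat) :
  (forall k, a k.+2 + a k <= (a k.+1).*2)%N ->
  forall i j, (i <= j)%N -> (a j.+1 + a i <= a j + a i.+1)%N.
Proof.
move=> ac i j /subnKC <-; elim: (j - i)%N => [|k IH]; first by rewrite addn0 addnC.
have := ac (i + k)%N; rewrite addnS; lia.
Qed.

Lemma concave_sym (a : nat -> nat) :
  (forall k, a k.+2 + a k <= (a k.+1).*2)%N ->
  forall h i, (i <= h)%N -> (a (h - i) + a (h + i) <= (a h).*2)%N.
Proof.
move=> ac h; elim=> [|i IH] ih; first by rewrite subn0 addn0 addnn.
have hi : (h - i.+1 <= h + i)%N by lia.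
have := IH (ltnW ih); have := concave_slopes ac hi.
have -> : ((h - i.+1).+1 = h - i)%N by lia.
rewrite addnS; lia.
Qed.

(** Pairing j with 2h - j, concavity bounds each pair by 2 a h; for j < s the pair loses
Y/2, because a j <= Y/2 and a (2h - j) <= B <= 2 a h - Y. *)
Lemma concave_sum_gap (a : nat -> nat) h s Y B :
  (forall k, a k.+2 + a k <= (a k.+1).*2)%N -> (forall j, a j <= B)%N ->
  (B + Y <= 2 * a h)%N -> (forall j, j < s -> 2 * a j <= Y)%N -> (s <= h.*2)%N ->
  (2 * (\sum_(j < h.*2) (a j + a j.+1)) + s * Y <= 4 * h.*2 * a h)%N.
Proof.
move=> ac aB aBY aY sh; set q := h.*2 in sh *.
have pair j : (j < q)%N -> (a j + a (q - j) <= 2 * a h)%N.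
  move=> jq; rewrite mul2n; have [jh|hj] := leqP j h.
    have := concave_sym ac (leq_subr j h).
    by rewrite subKn // addnBA // addnn.
  have jh : (j - h <= h)%N by rewrite /q in jq; lia.
  have := concave_sym ac jh; rewrite subnKC; last exact: ltnW.
  have -> : (h - (j - h) = q - j)%N by rewrite /q; lia.
  by rewrite addnC.
have pair' j : (j < s)%N -> (2 * (a j + a (q - j)) + Y <= 4 * a h)%N.
  by move=> js; have := aY _ js; have := aB (q - j)%N; lia.
have -> : (\sum_(j < q) (a j + a j.+1) = \sum_(j < q) (a j + a (q - j)))%N.
  rewrite !big_split /=; congr (_ + _)%N.
  rewrite (reindex_inj rev_ord_inj) /=; apply: eq_bigr => j _; congr a.
  by rewrite subnSK.
rewrite -(big_mkord xpredT (fun j => a j + a (q - j))%N).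
rewrite (big_cat_nat _ sh) //= mulnDr.
have S1 : (2 * \sum_(0 <= j < s) (a j + a (q - j)) + s * Y <= s * (4 * a h))%N.
  rewrite -{2 3}[s]subn0 -!sum_nat_const_nat big_distrr -big_split /=.
  rewrite big_nat [X in (_ <= X)%N]big_nat.
  by apply: leq_sum => j /pair'.
have S2 : (2 * \sum_(s <= j < q) (a j + a (q - j)) <= (q - s) * (4 * a h))%N.
  rewrite -sum_nat_const_nat big_distrr /= big_nat [X in (_ <= X)%N]big_nat.
  by apply: leq_sum => j /andP[_ /pair]; lia.
have <- : (s * (4 * a h) + (q - s) * (4 * a h) = 4 * q * a h)%N.
  by rewrite -mulnDl subnKC // mulnCA mulnA.
lia.
Qed.

Section QuadricNumbers.
Variable m : nat.
Local Notation n := m.*2.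
Local Notation Q := (quad n m).
Local Notation c := (kerdim 2 Q).

Lemma kerdim_quad1 : kerdim 1 Q = 1%N.
Proof.
rewrite kerdim0 ?exp1n // => v; rewrite /quad act_sum big1 // => i _.
have i2n : (i.*2 < n)%N by rewrite ltn_double.
by rewrite actM (nvarE i2n) -[msvar _ _]expr1 act_varX.
Qed.

(** On the box of size 2 the quadric F has F^2 = 0, so that its kernel has at least half of
the dimension; the corner shows that it has more. *)
Lemma quad_level1_gt : (2 ^ n < 2 * c)%N.
Proof.
have H := @kerdim_sq_lt_corner n m 1 (leqnn _) 0; rewrite addr0 in H; rewrite mul2n.
have := kerdim_double 1 (@halves_quad n m); rewrite kerdim_quad1 !muln1 => E.
by rewrite -E; apply: H => [|v]; rewrite act0 ?ffunE.
Qed.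

Lemma quad_frob (e k : nat) :
  kerdim (2 ^ (e + k)) (Q ^+ (2 ^ e)) = ((2 ^ e) ^ n * kerdim (2 ^ k) Q)%N.
Proof. by rewrite expnD kerdim_frob //; exact: halves_quad. Qed.

End QuadricNumbers.

Lemma kerdim_quadS m q : (kerdim q (quad m.+1.*2 m.+1) <=
  \sum_(j < q) (kerdim q (quad m.*2 m ^+ j) + kerdim q (quad m.*2 m ^+ j.+1)))%N.
Proof.
rewrite doubleS quadS.
by apply: kerdim_add_mul; apply: lifts_quad; lia.
Qed.

(** A crude bound, from the at most 2q diagonals of the last pair of variables: the kernel
has density at most 2/q in the box module. *)
Lemma kerdim_quad_le m q : (0 < m)%N -> (kerdim q (quad m.*2 m) * q <= 2 * q ^ m.*2)%N.
Proof.
case: m => // m _.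
apply: leq_trans (_ : (\sum_(j < q) (q ^ m.*2 + q ^ m.*2)) * q <= _)%N.
  rewrite leq_mul2r; apply/orP; right; apply: leq_trans (kerdim_quadS m q) _.
  by apply: leq_sum => j _; apply: leq_add; apply: kerdim_max.
by rewrite sum_nat_const card_ord doubleS !expnS; lia.
Qed.

(** With h = q/2 and a_j the kernel dimension of F^j, a h = h^(2m) c exceeds half of q^(2m)
by at least h^(2m)/2. For j <= 2^e the crude bound at level k makes a_j at most
h^(2m)/2; here k = 2m + 2 is what this takes. *)
Lemma kerdim_quadS_gap m e k q X : (0 < m)%N -> k = m.*2.+2 -> q = (2 ^ (e + k))%N ->
  X = ((2 ^ (e + k).-1) ^ m.*2 * kerdim 2 (quad m.*2 m))%N ->
  (2 * kerdim q (quad m.+1.*2 m.+1) + 2 ^ e * (2 ^ (e + k).-1) ^ m.*2 <= 4 * q * X)%N.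
Proof.
move=> m0 kE qE XE; pose a j := kerdim q (quad m.*2 m ^+ j).
pose h := (2 ^ (e + k).-1)%N; pose Y := (h ^ m.*2)%N.
have qh : q = h.*2 by rewrite qE /h -mul2n -expnS; congr (2 ^ _)%N; lia.
have ac j : (a j.+2 + a j <= (a j.+1).*2)%N by exact: kerdim_concave.
have a0 : a 0%N = 0%N by rewrite /a expr0 kerdim1.
have aX : a h = X.
  rewrite /a qE XE /h; have {1}-> : (e + k = (e + k).-1 + 1)%N by lia.
  by rewrite quad_frob.
have am i j : (i <= j)%N -> (a i <= a j)%N.
  move=> /subnKC <-; apply: kerdim_mono => v; rewrite exprD mulrC actM => ->.
  by rewrite linear0.
have aq j : (a j <= q ^ m.*2)%N by exact: kerdim_max.
have BY : (q ^ m.*2 = 2 ^ m.*2 * Y)%N by rewrite qh -mul2n expnMn.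
have X2 : (2 ^ m.*2 * Y + Y <= 2 * X)%N.
  rewrite XE -/h -/Y mulnCA -mulSnr mulnC leq_mul2l.
  by rewrite quad_level1_gt orbT.
have asmall j : (j <= 2 ^ e)%N -> (2 * a j <= Y)%N.
  move=> je; apply: leq_trans (_ : 2 * a (2 ^ e) <= _)%N; first by rewrite leq_mul2l am.
  rewrite /a qE quad_frob; have := @kerdim_quad_le m (2 ^ k) m0.
  set N := kerdim _ _ => NB.
  have : ((2 ^ e) ^ m.*2 * (N * 2 ^ k) <= (2 ^ e) ^ m.*2 * (2 * (2 ^ k) ^ m.*2))%N.
    by rewrite leq_mul2l NB orbT.
  rewrite [X in (_ <= X)%N]mulnCA -expnMn -expnD -qE BY kE !expnS.
  have : (0 < 2 ^ m.*2)%N by rewrite expn_gt0.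
  set w := (2 ^ m.*2)%N; set z := ((2 ^ e) ^ _)%N => w0.
  rewrite [X in (X <= _)%N](_ : _ = 2 * w * (2 * (z * N)))%N; last by ring.
  rewrite [X in (_ <= X)%N](_ : _ = 2 * w * Y)%N; last by ring.
  by rewrite leq_mul2l; case/orP => //; rewrite muln_eq0 /= eqn0Ngt w0.
have qe : (2 ^ e <= h.*2)%N by rewrite -qh qE leq_exp2l // leq_addr.
have := concave_sum_gap ac aq _ (fun j je => asmall j (ltnW je)) qe.
rewrite BY aX -qh => /(_ X2).
apply: leq_trans; rewrite leq_add2r leq_mul2l /=; exact: kerdim_quadS.
Qed.

(** * Limits of normalized kernel dimensions *)

Section NormalizedLimit.
Variables (K : realType) (d : nat) (k : nat -> nat) (C : nat).
Hypothesis k_grows : forall e, (2 ^ d * k e <= k e.+1)%N.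
Hypothesis k_bounded : forall e, (k e <= C * 2 ^ (e * d))%N.
Let u e : K := (k e)%:R / (2 ^ (e * d))%:R.

Let p_gt0 e : 0 < (2 ^ (e * d))%:R :> K.
Proof. by rewrite ltr0n expn_gt0. Qed.

Let u_nd : nondecreasing_seq u.
Proof.
apply/nondecreasing_seqP => e; rewrite /u ler_pdivrMr // mulrAC ler_pdivlMr //.
rewrite -!natrM ler_nat mulSn expnD mulnA.
by rewrite [(k e * _)%N]mulnC leq_mul2r k_grows orbT.
Qed.

Let u_cvg : cvgn u.
Proof.
apply: nondecreasing_is_cvgn => //; exists C%:R => _ [e _ <-].
by rewrite /u ler_pdivrMr // -natrM ler_nat.
Qed.

Lemma normalized_lim_ge e : u e <= limn u.
Proof. exact: nondecreasing_cvgn_le. Qed.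

Lemma normalized_lim_le e0 M : (forall e, (e0 <= e)%N -> u e <= M) -> limn u <= M.
Proof.
by move=> uM; apply: limr_le => //; near=> e; apply: uM; near: e; exact: nbhs_infty_ge.
Unshelve. all: by end_near. Qed.
End NormalizedLimit.

(** * The multiplicity of a hypersurface *)

Section Hypersurface.
Variables (K : realType) (d : nat) (f : mseries d.+1 'F_2) (A : comNzRingType).
Variable pr : {rmorphism mseries d.+1 'F_2 -> A}.
Hypothesis pr_surj : forall a, exists u, pr u = a.
Hypothesis pr_ker : forall u, pr u = 0 <-> exists h, u = h * f.
Hypothesis f0 : mscoef f mnm0 = 0.
Hypothesis f_halves : halves f.
Hypothesis f_bounded : forall q, (kerdim q f <= 3 * q ^ d)%N.
Hypothesis f_chain : exists P : nat -> mseries d.+1 'F_2 -> Prop,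
  (forall i, prime_pred (P i) /\ P i f) /\
  forall i, (i < d)%N -> strict_sub (P i) (P i.+1).

(** Zero would kill the whole box module, of dimension 4 * 4^d > 3 * 4^d at q = 4. *)
Lemma hypersurface_neq0 : f <> 0.
Proof.
move=> fz; have := f_bounded 4; rewrite fz kerdim0; last exact: act0.
by rewrite expnS leq_pmul2r // expn_gt0.
Qed.

Lemma hypersurface_krull_dim : krull_dim A = d.
Proof.
have [P [Pp Ps]] := f_chain.
exact: (krull_dim_hypersurface pr_surj pr_ker hypersurface_neq0 Pp Ps).
Qed.

Let k e := kerdim (2 ^ e) f.

Lemma eHK_lim : eHK K 2 A = limn (fun e => (k e)%:R / (2 ^ (e * d))%:R : K).
Proof.
rewrite /eHK hypersurface_krull_dim; congr (limn _); apply/funext => e.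
by rewrite (HK_kerdim pr_surj pr_ker f0).
Qed.

Let k_grows e : (2 ^ d * k e <= k e.+1)%N.
Proof.
have := kerdim_grows (2 ^ e) f_halves; rewrite expnS -mulnA leq_pmul2l //.
by rewrite -expnS.
Qed.

Let k_bounded e : (k e <= 3 * 2 ^ (e * d))%N.
Proof. by rewrite expnM; apply: f_bounded. Qed.

Lemma eHK_ge e : (kerdim (2 ^ e) f)%:R / (2 ^ (e * d))%:R <= eHK K 2 A.
Proof. by rewrite eHK_lim; exact: (normalized_lim_ge K k_grows k_bounded e). Qed.

Lemma eHK_le e0 M : (forall e, (e0 <= e)%N ->
  (kerdim (2 ^ e) f)%:R / (2 ^ (e * d))%:R <= M) -> eHK K 2 A <= M.
Proof. by rewrite eHK_lim; exact: (normalized_lim_le k_grows k_bounded). Qed.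

End Hypersurface.

Lemma kerdim_pow_bound n q (f : mseries n 'F_2) F a : lifts f F -> (0 < a)%N ->
  (kerdim q (F + nvar n.+1 n ^+ a) <= a * q ^ n)%N.
Proof.
move=> fF a0; have [aq|qa] := leqP a q.
  apply: leq_trans (kerdim_add_pow _ fF) _; first by rewrite a0.
  rewrite -[X in (_ <= X * _)%N]card_ord -sum_nat_const; apply: leq_sum => t _.
  exact: kerdim_max.
by apply: leq_trans (kerdim_max _ _) _; rewrite expnS leq_mul2r (ltnW qa) orbT.
Qed.

(** Here g0 = x_1 (x_2 x_3 + ...) + r' solves x_0 x_1 = the image of the other terms, all of
which are divisible by x_1. *)
Lemma quad_blowup d m (r r' : mseries d.+1 'F_2) : (0 < m)%N -> (m.*2 <= d.+1)%N ->
  mscoef r' mnm0 = 0 ->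
  (forall s : {rmorphism mseries d.+1 'F_2 -> mseries d.+1 'F_2},
    s (xvar d 1) = xvar d 1 ->
    (forall i, (1 < i <= d)%N -> s (xvar d i) = xvar d 1 * xvar d i) ->
    s r = xvar d 1 * r') ->
  exists P : nat -> mseries d.+1 'F_2 -> Prop,
  (forall i, prime_pred (P i) /\ P i (quad d.+1 m + r)) /\
  forall i, (i < d)%N -> strict_sub (P i) (P i.+1).
Proof.
case: m => // m _ md r'0 sr.
pose tl := \sum_(i < m) nvar d.+1 i.+1.*2 * nvar d.+1 i.+1.*2.+1.
have v0 i : mscoef (nvar d.+1 i) mnm0 = 0.
  by rewrite /nvar; case: insubP => [j _ _|//]; rewrite mscoef0_var.
apply: (@hypersurface_chain d _ (xvar d 1 * tl + r')); first lia.
  by rewrite mscoef0D mscoef0M mscoef0_var mul0r r'0 addr0.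
move=> s s0 s1 si; rewrite rmorphD (sr s s1 si) /quad big_ord_recl /= rmorphD rmorphM.
rewrite -!xvarE ?s0 ?s1; [|lia|lia].
rewrite rmorph_sum.
have -> : \sum_(i < m) s (nvar d.+1 (bump 0 i).*2 * nvar d.+1 (bump 0 i).*2.+1) =
    xvar d 1 * (xvar d 1 * tl).
  rewrite /tl !mulr_sumr; apply: eq_bigr => i _; have im := ltn_ord i.
  rewrite /bump /= add1n rmorphM -!xvarE ?si; [|lia|lia|lia|lia].
  by ring.
set x := xvar d 1; rewrite mulrC mulrDr -!addrA [X in _ + X]addrCA !addrA.
by rewrite mseries_char2 add0r mseries_char2.
Qed.

Lemma QserE d : Qser d = if odd d then quad d.+1 d.+1./2
  else quad d.+1 d./2 + nvar d.+1 d ^+ 2.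
Proof.
rewrite /Qser; case: ifP => od; last congr (_ + _ ^+ _); rewrite ?xvarE //;
  apply: eq_bigr => i _; have im := ltn_ord i; rewrite !xvarE //; lia.
Qed.

Lemma PserE d : (0 < d)%N -> Pser d = if odd d then
    quad d.+1 d.-1./2 + nvar d.+1 d.-1 ^+ 2 + nvar d.+1 d ^+ 3
  else quad d.+1 d./2 + nvar d.+1 d ^+ 3.
Proof.
move=> d0; rewrite /Pser; case: ifP => od;
  rewrite !xvarE; try lia; congr (_ + _); try congr (_ + _);
  apply: eq_bigr => i _; have im := ltn_ord i; rewrite !xvarE //; lia.
Qed.

Lemma quotient_pi (d : nat) (f : mseries d.+1 'F_2) (I : idealr (mseries d.+1 'F_2)) :
  (forall u, (u \in I) = `[< exists h, u = h * f >]) ->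
  exists pr : {rmorphism mseries d.+1 'F_2 -> {ideal_quot I}},
    (forall a, exists u, pr u = a) /\ (forall u, pr u = 0 <-> exists h, u = h * f).
Proof.
move=> IE; pose pr : {rmorphism mseries d.+1 'F_2 -> {ideal_quot I}} :=
  \pi_{ideal_quot I}%qT.
exists pr; split=> [a|u]; first by exists (repr a); exact: reprK.
have uE : (u \in I) = (pr u == pr 0) by rewrite -[u in LHS]subr0 Quotient.idealrBE.
rewrite rmorph0 IE in uE; split=> [/eqP|hu]; first by rewrite -uE => /asboolP.
by apply/eqP; rewrite -uE; apply/asboolP.
Qed.

(** * The four multiplicities *)

Local Notation c m := (kerdim 2 (quad m.*2 m)).

Lemma act_nvarX n q i k (v : boxmod n q) : (0 < q <= k)%N -> act (nvar n i ^+ k) v = 0.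
Proof.
move=> /andP[q0 qk]; rewrite -(subnK qk) exprD actM /nvar; case: insubP => [j _ _|_].
  by rewrite act_varX linear0.
by rewrite [0 ^+ q]expr0n eqn0Ngt q0 act0 linear0.
Qed.

Lemma kerdim_add_killed n q (f : mseries n 'F_2) i k : (0 < q <= k)%N ->
  kerdim q (f + nvar n i ^+ k) = kerdim q f.
Proof. by move=> qk; apply: eq_kerdim => v; rewrite actD act_nvarX // addr0. Qed.

Lemma quad_level1_lift m : kerdim 2 (quad m.*2.+1 m) = (2 * c m)%N.
Proof. by rewrite (kerdim_lift _ (lifts_quad (leqnn _))). Qed.

Section Bounds.
Variables (K : realType) (m : nat).
Hypothesis m_gt0 : (0 < m)%N.

Lemma eHK_R2_even : eHK K 2 (R2 m.*2) <= (2 * c m)%:R / (2 ^ m.*2)%:R.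
Proof.
have QE : Qser m.*2 = quad m.*2.+1 m + nvar m.*2.+1 m.*2 ^+ 2.
  by rewrite QserE odd_double doubleK.
have [pr [prs prk]] := @quotient_pi _ (Qser m.*2) (@idealQ m.*2) (fun u => erefl).
apply: (eHK_le prs prk (Qser0 _) _ _ _ (e0 := 1%N)) => [|q||[//|e] _].
- by rewrite QE; apply: halvesD; [exact: halves_quad|apply/halvesX/halves_nvar].
- rewrite QE; apply: leq_trans (kerdim_pow_bound _ (lifts_quad (leqnn _)) _) _ => //.
  by rewrite leq_mul2r orbT.
- rewrite QE; apply: (quad_blowup (r' := xvar m.*2 1 * nvar m.*2.+1 m.*2 ^+ 2)) => //.
    by rewrite mscoef0M mscoef0_var mul0r.
  move=> s s1 si; rewrite rmorphXn /= -xvarE // si ?leqnn ?andbT; last lia.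
  by ring.
rewrite ler_pdivrMr ?ltr0n ?expn_gt0 // mulrAC ler_pdivlMr ?ltr0n ?expn_gt0 //.
rewrite -!natrM ler_nat QE.
have e2 : (0 < 2 <= 2 ^ e.+1)%N by rewrite expnS leq_pmulr ?expn_gt0.
apply: leq_trans (_ : (2 * ((2 ^ e) ^ m.*2 * c m)) * 2 ^ m.*2 <= _)%N.
  rewrite leq_mul2r; apply/orP; right.
  apply: leq_trans (kerdim_add_pow e2 (lifts_quad (leqnn _))) _.
  have E t : (t < 2)%N -> ((2 ^ e.+1 - 2 + t) %/ 2).+1 = (2 ^ e)%N.
    move=> t2; have w0 : (0 < 2 ^ e)%N by rewrite expn_gt0.
    by rewrite expnS; move: w0; set w := (2 ^ e)%N => w0; lia.
  rewrite (eq_bigr (fun=> ((2 ^ e) ^ m.*2 * c m)%N)) => [|t _]; last first.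
    by rewrite (E t (ltn_ord t)); have := quad_frob m e 1; rewrite addn1 => ->.
  by rewrite sum_nat_const card_ord.
by rewrite mulSn expnD expnM; lia.
Qed.

Lemma eHK_S2_even : (2 * c m)%:R / (2 ^ m.*2)%:R < eHK K 2 (S2 m.*2).
Proof.
have PE : Pser m.*2 = quad m.*2.+1 m + nvar m.*2.+1 m.*2 ^+ 3.
  by rewrite PserE ?double_gt0 // odd_double doubleK.
have [pr [prs prk]] := @quotient_pi _ (Pser m.*2) (@idealP m.*2) (fun u => erefl).
have hP : halves (Pser m.*2).
  by rewrite PE; apply: halvesD; [exact: halves_quad|apply/halvesX/halves_nvar].
apply: lt_le_trans
  (_ : (kerdim (2 ^ 2) (Pser m.*2))%:R / (2 ^ (2 * m.*2))%:R <= _); last first.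
  apply: (eHK_ge K prs prk (Pser0 _)) => // [q|].
    by rewrite PE; apply: kerdim_pow_bound => //; exact: lifts_quad.
  rewrite PE.
  apply: (quad_blowup (r' := xvar m.*2 1 ^+ 2 * nvar m.*2.+1 m.*2 ^+ 3)) => //.
    by rewrite mscoef0M expr2 mscoef0M mscoef0_var !mul0r.
  move=> s s1 si; rewrite rmorphXn /= -xvarE // si ?leqnn ?andbT; last lia.
  by ring.
rewrite ltr_pdivrMr ?ltr0n ?expn_gt0 // mulrAC ltr_pdivlMr ?ltr0n ?expn_gt0 //.
rewrite -!natrM ltr_nat.
have c2 : (kerdim 2 (Pser m.*2) = 2 * c m)%N.
  by rewrite PE kerdim_add_killed // quad_level1_lift.
have := kerdim_double 2 hP; rewrite c2.
have m2 : (m.*2 < m.*2.+1)%N by [].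
have corner1 : corner m.*2.+1 m 3 (Ordinal m2) = 1%N :> nat.
  by rewrite ffunE /= ltnn inordK.
have z_ind : act (nvar m.*2.+1 m.*2 ^+ 3) (corner_ind m.*2.+1 m 3) = 0.
  by rewrite (nvarE m2) act_var_corner_ind // corner1.
have z_0 (v : boxmod m.*2.+1 4) :
    act (nvar m.*2.+1 m.*2 ^+ 3) v (corner m.*2.+1 m 3) = 0.
  by rewrite (nvarE m2) -[_ ^+ 3]mulr1 act_var_corner0 // corner1.
have := kerdim_sq_lt_corner (leqnSn _) z_ind z_0; rewrite -PE => H E.
have {}H : (2 ^ m.*2.+1 * (2 * c m) < 2 * kerdim (2 ^ 2) (Pser m.*2))%N.
  by rewrite -E [(2 * kerdim (2 ^ 2) _)%N]mul2n; exact: H.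
have w0 : (0 < 2 ^ m.*2)%N by rewrite expn_gt0.
have -> : (2 ^ (2 * m.*2) = 2 ^ m.*2 * 2 ^ m.*2)%N by rewrite -expnD addnn mul2n.
rewrite mulnA ltn_pmul2r // -(ltn_pmul2l (ltn0Sn 1)); apply: leq_trans H.
by rewrite expnS ltnS; lia.
Qed.

Lemma eHK_S2_odd : (2 * c m)%:R / (2 ^ m.*2)%:R <= eHK K 2 (S2 m.*2.+1).
Proof.
have PE : Pser m.*2.+1 = quad m.*2.+2 m + nvar m.*2.+2 m.*2 ^+ 2
    + nvar m.*2.+2 m.*2.+1 ^+ 3.
  by rewrite PserE //= odd_double /= doubleK.
have [pr [prs prk]] := @quotient_pi _ (Pser m.*2.+1) (@idealP m.*2.+1) (fun u => erefl).
have hP : halves (Pser m.*2.+1).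
  rewrite PE; apply: halvesD; [apply: halvesD|apply/halvesX/halves_nvar].
    exact: halves_quad.
  exact/halvesX/halves_nvar.
apply: le_trans
  (_ : (kerdim (2 ^ 1) (Pser m.*2.+1))%:R / (2 ^ (1 * m.*2.+1))%:R <= _);
  last first.
  apply: (eHK_ge K prs prk (Pser0 _)) => // [q|].
    rewrite PE; apply: kerdim_pow_bound => //.
    apply: liftsD; first exact: lifts_quad.
    by apply: liftsX; apply: lifts_var.
  rewrite PE -addrA; apply: (quad_blowup (r' := xvar m.*2.+1 1 * nvar m.*2.+2 m.*2 ^+ 2
    + xvar m.*2.+1 1 ^+ 2 * nvar m.*2.+2 m.*2.+1 ^+ 3)) => //; first lia.
    by rewrite mscoef0D expr2 !mscoef0M mscoef0_var !mul0r addr0.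
  move=> s s1 si; rewrite rmorphD !rmorphXn /= -!xvarE // !si; [|lia|lia].
  by ring.
rewrite expn1 mul1n PE !kerdim_add_killed //.
rewrite (kerdim_lift _ (lifts_quad (leqnSn _))) quad_level1_lift.
rewrite ler_pdivrMr ?ltr0n ?expn_gt0 // mulrAC ler_pdivlMr ?ltr0n ?expn_gt0 //.
by rewrite -!natrM ler_nat expnS; lia.
Qed.

(** Half of the gap in kerdim_quadS_gap is q^d / (4^m 2^(k+1)), a fixed proportion of q^d,
which is the second term of the bound M. *)
Lemma eHK_R2_odd : eHK K 2 (R2 m.*2.+1) < (2 * c m)%:R / (2 ^ m.*2)%:R.
Proof.
have QE : Qser m.*2.+1 = quad m.+1.*2 m.+1.
  by rewrite QserE /= odd_double /= doubleK.
have [pr [prs prk]] := @quotient_pi _ (Qser m.*2.+1) (@idealQ m.*2.+1) (fun u => erefl).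
pose k := m.*2.+2; pose w := (2 ^ m.*2)%N.
have w0 : (0 < w)%N by rewrite expn_gt0.
have k0 : (0 < 2 ^ k.+1)%N by rewrite expn_gt0.
pose M : K := (4 * c m * 2 ^ k)%:R / (w * 2 ^ k.+1)%:R - 1 / (w * 2 ^ k.+1)%:R.
apply: le_lt_trans (_ : M < _); last first.
  have -> : (2 * c m)%:R / w%:R = (4 * c m * 2 ^ k)%:R / (w * 2 ^ k.+1)%:R :> K.
    have wK : (w%:R : K) != 0 by rewrite pnatr_eq0 -lt0n.
    have wkK : ((w * 2 ^ k.+1)%:R : K) != 0 by rewrite pnatr_eq0 -lt0n muln_gt0 w0.
    apply/eqP; rewrite (eqr_div _ _ wK wkK) -!natrM eqr_nat.
    by rewrite expnS; apply/eqP; ring.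
  by rewrite /M ltrBlDr ltrDl divr_gt0 // ltr0n muln_gt0 w0.
apply: (eHK_le prs prk (Qser0 _) _ _ _ (e0 := k)) => [|q||e ke].
- by rewrite QE; exact: halves_quad.
- rewrite QE; apply: leq_trans (kerdim_quadS m q) _.
  apply: leq_trans (_ : (\sum_(j < q) (q ^ m.*2 + q ^ m.*2)) <= _)%N.
    by apply: leq_sum => j _; apply: leq_add; apply: kerdim_max.
  by rewrite sum_nat_const card_ord expnS; lia.
- rewrite QE -[quad _ _]addr0; apply: (quad_blowup (r' := 0)) => //.
  by move=> s _ _; rewrite rmorph0 mulr0.
have eE : e = (e - k + k)%N by rewrite subnK.
have := kerdim_quadS_gap m_gt0 (erefl k) (congr1 (expn 2) eE) erefl.
rewrite -eE -QE; set N := kerdim _ _; set h := (2 ^ e.-1)%N.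
have qh : (2 ^ e = 2 * h)%N by rewrite /h -expnS prednK // (leq_trans _ ke).
set E := (2 ^ (e - k))%N => H.
have EE : (E * 2 ^ k = 2 ^ e)%N by rewrite -expnD -eE.
have hw : (w * h ^ m.*2 = (2 ^ e) ^ m.*2)%N by rewrite qh expnMn.
have p1 : (0 : K) < (w * 2 ^ k.+1)%:R by rewrite ltr0n muln_gt0 w0.
have p2 : (0 : K) < (2 ^ (e * m.*2.+1))%:R by rewrite ltr0n expn_gt0.
rewrite /M -mulrBl (ler_pdivrMr _ _ p2) mulrAC (ler_pdivlMr _ _ p1).
rewrite mulrBl mul1r lerBrDr -!natrM -natrD ler_nat.
rewrite mulnS expnD [(e * _)%N]mulnC; rewrite mulnC in hw.
have -> : (2 ^ (m.*2 * e) = h ^ m.*2 * w)%N by rewrite hw -expnM mulnC.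
have : ((2 * N + E * h ^ m.*2) * (w * 2 ^ k) <=
    4 * 2 ^ e * (h ^ m.*2 * c m) * (w * 2 ^ k))%N.
  by rewrite leq_mul2r H orbT.
rewrite -EE expnS; set H1 := (h ^ m.*2)%N; set k1 := (2 ^ k)%N; lia.
Qed.
End Bounds.

Theorem theorem3p12 (K : realType) (d : nat) (d_ge2 : (2 <= d)%N) :
  eHK K 2 (S2 d) > eHK K 2 (R2 d).
Proof.
have m0 : (0 < d./2)%N by rewrite half_gt0.
rewrite -[d]odd_double_half; case: (odd d); rewrite ?add1n ?add0n.
  exact: lt_le_trans (eHK_R2_odd K m0) (eHK_S2_odd K m0).
exact: le_lt_trans (eHK_R2_even K m0) (eHK_S2_even K m0).
Qed.
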